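(* Let $E$ be a separable Banach space over $K$ with dual $E^*$, and let $X$ be an $E$-valued random variable. Then $X$ is $K$-Gaussian if and only if $T(X)$ is $K$-Gaussian for every $T\in E^*$.
   Context: $K$ is a local field (locally compact, non-discrete, totally disconnected topological field) with its non-archimedean absolute value $|\cdot|$ ($|x|=0\iff x=0$, $|xy|=|x||y|$, $|x+y|\le|x|\vee|y|$). A normed space over $K$ is a $K$-vector space $E$ with a map $\|\cdot\|:E\to[0,\infty)$ such that $\|x\|=0\iff x=0$, $\|\alpha x\|=|\alpha|\|x\|$, $\|x+y\|\le\|x\|\vee\|y\|$; it is a Banach space if complete. $E^*$ denotes the space of continuous $K$-linear functionals $E\to K$. A subset $F$ of a normed space is orthogonal if $\|\sum_{i=1}^n\alpha_ix_i\|=\bigvee_{i=1}^n|\alpha_i|\|x_i\|$ for all finite $\{x_1,\dots,x_n\}\subset F$ and $\alpha_i\in K$; orthonormal if moreover all its elements have norm $1$. $K^2$ is normed by $|(x_1,x_2)|=|x_1|\vee|x_2|$. For a separable Banach space $E$ over $K$, an $E$-valued random variable $X$ is $K$-Gaussian if whenever $X_1,X_2$ are two independent copies of $X$ and $(\alpha_{11},\alpha_{12}),(\alpha_{21},\alpha_{22})\in K^2$ are orthonormal, $(\alpha_{11}X_1+\alpha_{12}X_2,\alpha_{21}X_1+\alpha_{22}X_2)$ has the same law as $(X_1,X_2)$. (In particular $K$ itself is such a space.) *)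

(* Defs.v *)
From HB Require Import structures.
From mathcomp Require Import all_boot all_order all_algebra.
From mathcomp Require Import all_classical all_reals all_analysis.
Set Implicit Arguments. Unset Strict Implicit. Unset Printing Implicit Defensive.
Import Order.TTheory GRing.Theory Num.Theory.
Local Open Scope classical_set_scope.
Local Open Scope ring_scope.

Section Defs.
Variable R : realType.
Variable K : fieldType.

Definition nonarch_abs (absK : K -> R) : Prop :=
  [/\ (forall x, 0 <= absK x),
      (forall x, absK x = 0 <-> x = 0),
      (forall x y, absK (x * y) = absK x * absK y) &
      (forall x y, absK (x + y) <= Num.max (absK x) (absK y))].

(** Local field: K with its non-archimedean absolute value, whose induced
    (metric) topology is non-discrete and locally compact.  Local compactness
    is written out for this metric: some closed ball of positive radius around
    0 is (sequentially) compact.  Total disconnectedness is automatic for an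
    ultrametric topology. *)
Definition local_field (absK : K -> R) : Prop :=
  [/\ nonarch_abs absK,
      (exists x : K, 0 < absK x < 1) &
      (exists2 r : R, 0 < r &
        forall u : nat -> K, (forall n, absK (u n) <= r) ->
        exists phi : nat -> nat, (forall n, (phi n < phi n.+1)%N) /\
        exists2 l : K, absK l <= r &
          forall e : R, 0 < e -> exists N, forall n, (N <= n)%N ->
            absK (u (phi n) - l) < e)].

Definition nonarch_norm (absK : K -> R) (V : lmodType K) (normV : V -> R) : Prop :=
  [/\ (forall x, 0 <= normV x),
      (forall x, normV x = 0 <-> x = 0),
      (forall (a : K) x, normV (a *: x) = absK a * normV x) &
      (forall x y, normV (x + y) <= Num.max (normV x) (normV y))].

Definition separable_banach (absK : K -> R) (V : lmodType K) (normV : V -> R) : Prop :=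
  [/\ nonarch_norm absK normV,
      (forall u : nat -> V,
         (forall e : R, 0 < e -> exists N, forall m n, (N <= m)%N -> (N <= n)%N ->
            normV (u m - u n) < e) ->
         exists l : V, forall e : R, 0 < e -> exists N, forall n, (N <= n)%N ->
            normV (u n - l) < e) &
      (exists u : nat -> V, forall x e, 0 < e -> exists n, normV (x - u n) < e)].

Definition dual_elem (absK : K -> R) (V : lmodType K) (normV : V -> R) (T : V -> K) : Prop :=
  (forall (a : K) (x y : V), T (a *: x + y) = a * T x + T y) /\
  (forall x (e : R), 0 < e -> exists2 d : R, 0 < d &
     forall y, normV (x - y) < d -> absK (T x - T y) < e).

Definition mopen (S : Type) (dist : S -> S -> R) (U : set S) : Prop :=
  forall x, U x -> exists2 e : R, 0 < e & forall y, dist x y < e -> U y.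

Definition mborel (S : Type) (dist : S -> S -> R) : set (set S) :=
  <<s mopen dist >>.

Definition ndist (V : lmodType K) (normV : V -> R) (x y : V) : R := normV (x - y).

Definition pdist (V : lmodType K) (normV : V -> R) (p q : V * V) : R :=
  Num.max (normV (p.1 - q.1)) (normV (p.2 - q.2)).

Definition norm2 (absK : K -> R) (v : K * K) : R := Num.max (absK v.1) (absK v.2).

Definition orthonormal2 (absK : K -> R) (a b : K * K) : Prop :=
  [/\ norm2 absK a = 1, norm2 absK b = 1 &
      forall al be : K,
        norm2 absK (al * a.1 + be * b.1, al * a.2 + be * b.2)
        = Num.max (absK al * norm2 absK a) (absK be * norm2 absK b)].

Definition random_var (V : lmodType K) (normV : V -> R)
  (d : measure_display) (O : measurableType d) (X : O -> V) : Prop :=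
  forall A, mborel (ndist normV) A -> measurable (X @^-1` A).

Definition same_law (V : lmodType K) (normV : V -> R)
  (d1 : measure_display) (O1 : measurableType d1) (P1 : probability O1 R) (X1 : O1 -> V)
  (d2 : measure_display) (O2 : measurableType d2) (P2 : probability O2 R) (X2 : O2 -> V) :=
  forall A, mborel (ndist normV) A -> P1 (X1 @^-1` A) = P2 (X2 @^-1` A).

Definition indep2 (V : lmodType K) (normV : V -> R)
  (d : measure_display) (O : measurableType d) (P : probability O R) (X1 X2 : O -> V) :=
  forall A B, mborel (ndist normV) A -> mborel (ndist normV) B ->
    P (X1 @^-1` A `&` X2 @^-1` B) = (P (X1 @^-1` A) * P (X2 @^-1` B))%E.

Definition KGaussian (absK : K -> R) (V : lmodType K) (normV : V -> R)
  (d : measure_display) (O : measurableType d) (P : probability O R) (X : O -> V) : Prop :=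
  forall (d' : measure_display) (O' : measurableType d') (P' : probability O' R)
         (X1 X2 : O' -> V),
    random_var normV X1 -> random_var normV X2 ->
    same_law normV P' X1 P X -> same_law normV P' X2 P X ->
    indep2 normV P' X1 X2 ->
    forall a b : K * K, orthonormal2 absK a b ->
    forall B, mborel (pdist normV) B ->
      P' ((fun w => (a.1 *: X1 w + a.2 *: X2 w, b.1 *: X1 w + b.2 *: X2 w)) @^-1` B)
      = P' ((fun w => (X1 w, X2 w)) @^-1` B).

End Defs.

(* Main.v *)
(* One direction only pushes a pair of independent copies of X through (T, T).

   For the converse, the shear (Z1, Z2) -> (Z1 + u Z2, Z2) with |u| <= 1 shows
   that the law of a K-Gaussian Z on K is, at each scale r, invariant under
   translation by u z whenever the r-ball around z has positive mass; in
   particular Z is almost surely bounded.  The laws of the forms T(X) determine the mass of a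
   polydisc {x | |T_k x - c_k| < r for all k < n}: its indicator is, on bounded
   sets, a combination of indicators of slabs of the forms sum_k e_k T_k,
   averaged over e in the unit ball (an elementary Cramer-Wold inversion).  Hence
   the translation invariance passes from the forms T(X) to X: at each scale the
   polydiscs of positive mass all have the same mass, and their centres form a
   module over the unit ball of K.  A matrix with orthonormal rows has
   determinant of absolute value 1, so it permutes products of two polydiscs and
   preserves this uniform law on pairs.  By Hahn-Banach over the spherically
   complete field K, countably many forms T_k define the topology of E, and the
   corresponding polydiscs generate its Borel sets. *)
Require Import Defs.
From HB Require Import structures.
From mathcomp Require Import all_boot all_order all_algebra.
From mathcomp Require Import all_classical all_reals all_analysis.
From mathcomp Require Import measurable_realfun.
From mathcomp Require Import ring lra.
Set Implicit Arguments. Unset Strict Implicit. Unset Printing Implicit Defensive.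
Import Order.TTheory GRing.Theory Num.Theory.
Import numFieldNormedType.Exports.
Local Open Scope classical_set_scope.
Local Open Scope ring_scope.

(** * Agreement of laws on Borel sets *)

(** Measurability of both preimages is bundled with the equality, so that the sets of agreement form
    a Dynkin system with no prior assumption on [f1] and [f2]. *)
Definition prob_agree {R : realType} {S : Type}
    {d1} {O1 : measurableType d1} (P1 : probability O1 R) (f1 : O1 -> S)
    {d2} {O2 : measurableType d2} (P2 : probability O2 R) (f2 : O2 -> S)
    (B : set S) :=
  [/\ measurable (f1 @^-1` B), measurable (f2 @^-1` B) &
      P1 (f1 @^-1` B) = P2 (f2 @^-1` B)].

(** Dynkin's pi-lambda theorem. *)
Lemma prob_agree_sigma {R : realType} {S : Type}
    {d1} {O1 : measurableType d1} (P1 : probability O1 R) (f1 : O1 -> S)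
    {d2} {O2 : measurableType d2} (P2 : probability O2 R) (f2 : O2 -> S)
    (G : set (set S)) :
  setI_closed G -> (forall B, G B -> prob_agree P1 f1 P2 f2 B) ->
  forall B, <<s G >> B -> prob_agree P1 f1 P2 f2 B.
Proof.
move=> GI GP; rewrite -(setI_closed_g_dynkin_g_sigma_algebra GI).
apply: (@smallest_sub _ (@dynkin S) G); last by move=> B; exact: GP.
split=> [|B [m1 m2 e]|F tF FP].
- by split; rewrite ?preimage_setT //; rewrite !probability_setT.
- by split; rewrite -?preimage_setC; [exact: measurableC|exact: measurableC|];
    rewrite !probability_setC // e.
- have m1 k : measurable (f1 @^-1` F k) by case: (FP k).
  have m2 k : measurable (f2 @^-1` F k) by case: (FP k).
  split; rewrite !preimage_bigcup; [exact: bigcupT_measurable..|].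
  have tI (T : Type) (f : T -> S) : trivIset setT (fun k => f @^-1` F k).
    by move=> i j _ _ [w [wi wj]]; apply: tF => //; exists (f w).
  rewrite !measure_bigcup; do ?[exact: tI|exact: m1|exact: m2|by []].
  by apply: eq_eseriesr => k _; case: (FP k).
Qed.

(* The classes of a decreasing sequence of equivalence relations are pairwise
   nested or disjoint, hence form a pi-system together with the empty set. *)
Definition classes {S : Type} (r : nat -> S -> S -> Prop) : set (set S) :=
  [set B | B = set0 \/ exists m x, B = [set y | r m x y]].

Section Classes.
Context {R : realType} {S : Type} {dist : S -> S -> R}.
Context {r : nat -> S -> S -> Prop} {u : nat -> S}.
Hypothesis rsym : forall m x y, r m x y -> r m y x.
Hypothesis rtrans : forall m x y z, r m x y -> r m y z -> r m x z.
Hypothesis rle : forall m n x y, (m <= n)%N -> r n x y -> r m x y.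
Hypothesis rdense : forall m x, exists n, r m (u n) x.
Hypothesis rsmall : forall (e : R), 0 < e -> exists m, forall x y, r m x y -> dist x y < e.

Lemma classes_setI : setI_closed (classes r).
Proof.
move=> A B [->|[m [x ->]]]; first by left; rewrite set0I.
move=> [->|[n [y ->]]]; first by left; rewrite setI0.
have [[z [rxz ryz]]|h] := pselect (exists z, r m x z /\ r n y z); last first.
  by left; rewrite -subset0 => z [rx ry]; apply: h; exists z.
right; case/orP: (leq_total m n) => mn.
- exists n, z; apply/seteqP; split=> [w [rw1 rw2]|w rw] /=.
    by apply: rtrans rw2; exact: rsym.
  by split; [apply: rtrans rxz _; exact: rle mn rw|exact: rtrans ryz rw].
- exists m, z; apply/seteqP; split=> [w [rw1 rw2]|w rw] /=.
    by apply: rtrans rw1; exact: rsym.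
  by split; [exact: rtrans rxz rw|apply: rtrans ryz _; exact: rle mn rw].
Qed.

(** An open set is the countable union of the classes of the points [u n] that it contains, since
    classes become arbitrarily small and every class meets the sequence [u]. *)
Lemma mborel_classes : mborel dist `<=` <<s classes r >>.
Proof.
apply: (@smallest_sub _ (@sigma_algebra S setT)); first exact: smallest_sigma_algebra.
move=> U oU.
(* The inclusion condition sits inside the set, so [F k] is either a full class or empty. *)
pose F (k : nat) : set S :=
  if unpickle k is Some (m, n) then
    [set y | r m (u n) y /\ [set y | r m (u n) y] `<=` U] else set0.
have -> : U = \bigcup_k F k.
  apply/seteqP; split=> [x Ux|x [k _]]; last first.
    by rewrite /F; case: (unpickle k) => [[m n]|//] /= [h]; apply.
  have [e e0 he] := oU _ Ux; have [m hm] := rsmall e0.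
  have [n hn] := rdense m x.
  exists (pickle (m, n)) => //; rewrite /F pickleK /=; split=> // y ry.
  by apply: he; apply: hm; apply: rtrans ry; exact: rsym.
have [s0 sC sU] := @smallest_sigma_algebra S setT (classes r).
apply: sU => k; rewrite /F; case: (unpickle k) => [[m n]|]; last first.
  by apply: sub_gen_smallest; left.
have [h|h] := pselect ([set y | r m (u n) y] `<=` U); apply: sub_gen_smallest.
  by right; exists m, (u n); apply/seteqP; split=> y //= [].
by left; rewrite -subset0 => y [].
Qed.

Lemma prob_agree_classes
    {d1} {O1 : measurableType d1} (P1 : probability O1 R) (f1 : O1 -> S)
    {d2} {O2 : measurableType d2} (P2 : probability O2 R) (f2 : O2 -> S) :
  (forall m x, prob_agree P1 f1 P2 f2 [set y | r m x y]) ->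
  forall B, mborel dist B -> prob_agree P1 f1 P2 f2 B.
Proof.
move=> h B /mborel_classes; apply: prob_agree_sigma; first exact: classes_setI.
move=> _ [->|[m [x ->]]] //; split; rewrite ?preimage_set0 ?measure0 //.
Qed.

End Classes.

(** * Ultrametric norms and local fields *)

Section Ultrametric.
Context {R : realType} {K : fieldType} {absK : K -> R}.
Hypothesis hA : nonarch_abs absK.

Lemma abs_ge0 x : 0 <= absK x. Proof. by case: hA. Qed.

Lemma absM x y : absK (x * y) = absK x * absK y. Proof. by case: hA. Qed.

Lemma abs_eq0 x : (absK x == 0) = (x == 0).
Proof. by case: hA => _ h _ _; apply/eqP/eqP => /h. Qed.

Lemma abs_gt0 x : (0 < absK x) = (x != 0).
Proof. by rewrite lt_neqAle abs_ge0 andbT eq_sym abs_eq0. Qed.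

Lemma abs0 : absK 0 = 0. Proof. by apply/eqP; rewrite abs_eq0. Qed.

Lemma abs1 : absK 1 = 1.
Proof.
have h : absK 1 != 0 by rewrite abs_eq0 oner_neq0.
by apply: (mulfI h); rewrite -absM !mulr1.
Qed.

Lemma absV x : absK x^-1 = (absK x)^-1.
Proof.
have [->|x0] := eqVneq x 0; first by rewrite invr0 abs0 invr0.
have h : absK x != 0 by rewrite abs_eq0.
by apply: (mulfI h); rewrite -absM !mulfV // abs1.
Qed.

Lemma absX x n : absK (x ^+ n) = absK x ^+ n.
Proof. by elim: n => [|n ih]; rewrite ?expr0 ?abs1 // !exprS absM ih. Qed.

Lemma absN1 : absK (-1) = 1.
Proof.
apply/eqP; rewrite -(eqrXn2 (n := 2)) // ?abs_ge0 //.
by rewrite expr1n -absX sqrrN expr1n abs1.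
Qed.

Lemma abs_nonarch_norm : nonarch_norm absK (absK : K^o -> R).
Proof. by case: hA. Qed.

Context {V : lmodType K} {normV : V -> R}.
Hypothesis hN : nonarch_norm absK normV.

Lemma norm_ge0 x : 0 <= normV x. Proof. by case: hN. Qed.

Lemma norm_eq0 x : (normV x == 0) = (x == 0).
Proof. by case: hN => _ h _ _; apply/eqP/eqP => /h. Qed.

Lemma norm_gt0 x : (0 < normV x) = (x != 0).
Proof. by rewrite lt_neqAle norm_ge0 andbT eq_sym norm_eq0. Qed.

Lemma norm0 : normV 0 = 0. Proof. by apply/eqP; rewrite norm_eq0. Qed.

Lemma normZ a x : normV (a *: x) = absK a * normV x. Proof. by case: hN. Qed.

Lemma normN x : normV (- x) = normV x.
Proof. by rewrite -scaleN1r normZ absN1 mul1r. Qed.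

Lemma normBC x y : normV (x - y) = normV (y - x).
Proof. by rewrite -normN opprB. Qed.

Lemma normD_le x y r : normV x <= r -> normV y <= r -> normV (x + y) <= r.
Proof.
by move=> hx hy; case: hN => _ _ _ h; apply: le_trans (h x y) _; rewrite ge_max hx.
Qed.

Lemma normD_lt x y r : normV x < r -> normV y < r -> normV (x + y) < r.
Proof.
by move=> hx hy; case: hN => _ _ _ h; apply: le_lt_trans (h x y) _; rewrite gt_max hx.
Qed.

Lemma normB_le x y r : normV x <= r -> normV y <= r -> normV (x - y) <= r.
Proof. by move=> hx hy; apply: normD_le => //; rewrite normN. Qed.

Lemma normB_lt x y r : normV x < r -> normV y < r -> normV (x - y) < r.
Proof. by move=> hx hy; apply: normD_lt => //; rewrite normN. Qed.

Lemma norm_dist_le x y z r :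
  normV (x - y) <= r -> normV (y - z) <= r -> normV (x - z) <= r.
Proof. by move=> h1 h2; rewrite -(subrKA y) addrC; apply: normD_le. Qed.

Lemma norm_dist_lt x y z r :
  normV (x - y) < r -> normV (y - z) < r -> normV (x - z) < r.
Proof. by move=> h1 h2; rewrite -(subrKA y) addrC; apply: normD_lt. Qed.

(** Ultrametric triangles are isosceles. *)
Lemma norm_close x y : normV (x - y) < normV x -> normV y = normV x.
Proof.
move=> h; apply/eqP; rewrite eq_le; apply/andP; split.
  by rewrite -(subKr x y); apply: normB_le => //; exact: ltW.
rewrite leNgt; apply/negP => h2.
by have := normD_lt h h2; rewrite subrK ltxx.
Qed.

End Ultrametric.

Section UltrametricAbs.
Context {R : realType} {K : fieldType} {absK : K -> R}.
Hypothesis hA : nonarch_abs absK.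
Let hN := abs_nonarch_norm hA.
Implicit Types x y z : K.

Lemma absN x : absK (- x) = absK x. Proof. exact: (normN hA hN). Qed.

Lemma absBC x y : absK (x - y) = absK (y - x). Proof. exact: (normBC hA hN). Qed.

Lemma absD_le x y r : absK x <= r -> absK y <= r -> absK (x + y) <= r.
Proof. exact: (normD_le hN). Qed.

Lemma absD_lt x y r : absK x < r -> absK y < r -> absK (x + y) < r.
Proof. exact: (normD_lt hN). Qed.

Lemma absB_le x y r : absK x <= r -> absK y <= r -> absK (x - y) <= r.
Proof. exact: (normB_le hA hN). Qed.

Lemma absB_lt x y r : absK x < r -> absK y < r -> absK (x - y) < r.
Proof. exact: (normB_lt hA hN). Qed.

Lemma abs_dist_lt x y z r :
  absK (x - y) < r -> absK (y - z) < r -> absK (x - z) < r.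
Proof. exact: (norm_dist_lt hN). Qed.

Lemma abs_close x y : absK (x - y) < absK x -> absK y = absK x.
Proof. exact: (norm_close hA hN). Qed.

End UltrametricAbs.

Lemma expr_lt_eps {R : realType} (t e : R) : 0 <= t < 1 -> 0 < e -> exists n, t ^+ n < e.
Proof.
move=> /andP[t0 t1] e0.
have /cvgrPdist_lt /(_ e e0) [N _ hN] : (GRing.exp t : R^nat) @ \oo --> (0 : R).
  by apply: cvg_expr; rewrite ger0_norm.
exists N; have := hN N (leqnn N); rewrite /= sub0r normrN ger0_norm //.
exact: exprn_ge0.
Qed.

Lemma invS_lt_eps {R : realType} (e : R) (n : nat) :
  0 < e -> (Num.bound e^-1 <= n)%N -> n.+1%:R^-1 < e.
Proof.
move=> e0 en; have e'0 : 0 <= e^-1 by rewrite invr_ge0 ltW.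
rewrite -[ltRHS]invrK ltf_pV2 ?posrE ?ltr0n ?invr_gt0 //.
by rewrite (lt_le_trans (archi_boundP e'0)) // ler_nat leqW.
Qed.

(** * Compactness and separability of local fields *)

Section LocalField.
Context {R : realType} {K : fieldType} {absK : K -> R}.
Hypothesis hK : local_field absK.
Let hA : nonarch_abs absK. Proof. by case: hK. Qed.

(** Multiplication by a high power of [t] moves the sequence into the compact ball of radius [r];
    the limit is then scaled back. *)
Lemma bounded_subseq (u : nat -> K) (B : R) : (forall n, absK (u n) <= B) ->
  exists2 phi : nat -> nat, (forall n, (phi n < phi n.+1)%N) &
  exists l, forall e : R, 0 < e -> exists N, forall n, (N <= n)%N -> absK (u (phi n) - l) < e.
Proof.
move=> uB; case: hK => _ [t /andP[t0 t1]] [r r0 hc].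
have B0 : 0 <= B by apply: le_trans (uB 0%N); exact: abs_ge0.
have [j hj] : exists j, absK t ^+ j < r / (B + 1).
  by apply: expr_lt_eps; rewrite ?ltW // divr_gt0 // ltr_wpDl.
have tj : 0 < absK (t ^+ j) by rewrite absX // exprn_gt0.
have tj0 : t ^+ j != 0 by rewrite -(abs_gt0 hA).
have [n|phi [hphi [l _ hl]]] := hc (fun n => t ^+ j * u n).
  rewrite absM //; apply: (@le_trans _ _ (absK (t ^+ j) * (B + 1))).
    by rewrite ler_wpM2l ?(abs_ge0 hA) // (le_trans (uB n)) // lerDl.
  by rewrite -ler_pdivlMr ?ltr_wpDl // absX // ltW.
exists phi => //; exists (l / t ^+ j) => e e0.
have [N hN] := hl _ (mulr_gt0 tj e0).
exists N => n Nn; have := hN n Nn.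
by rewrite -{1}(divfK tj0 l) [_ / _ * _]mulrC -mulrBr absM // ltr_pM2l.
Qed.

Lemma compact_cover (B e : R) : 0 < e ->
  exists s : seq K, forall x, absK x <= B -> has (fun y => absK (x - y) < e) s.
Proof.
move=> e0; apply: contrapT => /forallNP h.
have {h} [f hf] : {f : seq K -> K & forall s, absK (f s) <= B /\
    forall y, y \in s -> e <= absK (f s - y)}.
  apply: (@choice _ _ (fun s x => absK x <= B /\ forall y, y \in s -> e <= absK (x - y))).
  move=> s; have /existsNP[x /not_implyP[xB /negP/hasPn hx]] := h s.
  by exists x; split=> // y /hx; rewrite -leNgt.
pose S := fix S n := if n is n'.+1 then f (S n') :: S n' else [::].
pose u n := f (S n).
have uS m n : (m < n)%N -> u m \in S n.
  elim: n => // n ih; rewrite ltnS leq_eqVlt => /orP[/eqP->|/ih h] /=.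
    exact: mem_head.
  by rewrite in_cons h orbT.
have [phi hphi [l hl]] := @bounded_subseq u B (fun n => (hf (S n)).1).
have [N hN] := hl e e0.
have /(hf _).2 := uS _ _ (hphi N); rewrite leNgt => /negP; apply.
apply: (abs_dist_lt hA (y := l)); first exact: hN.
by rewrite (absBC hA); exact: hN.
Qed.

Lemma local_field_separable :
  exists u : nat -> K, forall x (e : R), 0 < e -> exists n, absK (x - u n) < e.
Proof.
have /choice[s hs] : forall k : nat, exists s : seq K, forall x, absK x <= k%:R ->
    has (fun y => absK (x - y) < k.+1%:R^-1) s.
  by move=> k; apply: compact_cover; rewrite invr_gt0 ltr0n.
exists (fun n => if unpickle n is Some (k, i) then nth 0 (s k) i else 0) => x e e0.
(* The index [k] controls both the ball, which must contain [x], and the mesh of the net, which must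
   be below [e]. *)
pose k := maxn (Num.bound (absK x)) (Num.bound e^-1).
have xk : absK x <= k%:R.
  rewrite ltW // (lt_le_trans (archi_boundP (abs_ge0 hA x))) //.
  by rewrite ler_nat leq_maxl.
have ek : k.+1%:R^-1 < e by rewrite invS_lt_eps // leq_maxr.
have /hasP[y ys hy] := hs k x xk.
exists (pickle (k, index y (s k))); rewrite pickleK nth_index //.
exact: lt_trans ek.
Qed.

(* A finite system [F] of representatives of the closed unit ball modulo the
   open ball of radius [e]. *)
Lemma finite_reps (e : R) : 0 < e -> e <= 1 ->
  exists (F : seq K) (rep : K -> K),
  [/\ uniq F, (forall y, y \in F -> absK y <= 1 /\ rep y = y),
      (forall x, absK x <= 1 -> rep x \in F /\ absK (x - rep x) < e) &
      (forall x y, absK (x - y) < e -> rep x = rep y)].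
Proof.
move=> e0 e1; have [s hs] := @compact_cover 1 e e0.
(* The first net point close to [x] depends only on the ball of radius [e] around [x], because these
   balls partition [K]. *)
pose rep x := nth 0 s (find (fun y => absK (x - y) < e) s).
have repE x y : absK (x - y) < e -> rep x = rep y.
  move=> h; rewrite /rep; congr nth; apply: eq_find => z.
  apply/idP/idP; apply: (abs_dist_lt hA) => //.
  by rewrite (absBC hA).
have repP x : absK x <= 1 -> absK (x - rep x) < e.
  by move=> /hs h; have := nth_find 0 h.
have rep1 x : absK x <= 1 -> absK (rep x) <= 1.
  move=> x1; rewrite -(subKr x (rep x)); apply: (absB_le hA) => //.
  exact: ltW (lt_le_trans (repP x x1) e1).
exists (undup (map rep [seq y <- s | absK y <= 1])), rep.
split=> // [|y|x x1]; first by rewrite undup_uniq.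
  rewrite mem_undup => /mapP[z]; rewrite mem_filter => /andP[z1 _] ->.
  by split; [exact: rep1|apply/esym/repE/repP].
split; last exact: repP.
rewrite mem_undup (repE _ _ (repP x x1)) map_f //; rewrite mem_filter rep1 //=.
by rewrite mem_nth // -has_find; have := hs x x1.
Qed.

End LocalField.

(** * The Hahn-Banach theorem *)

Section HahnBanach.
Context {R : realType} {K : fieldType} {absK : K -> R}.
Hypothesis hK : local_field absK.
Context {V : lmodType K} {normV : V -> R}.
Hypothesis hN : nonarch_norm absK normV.
Let hA : nonarch_abs absK. Proof. by case: hK. Qed.

(* Spherical completeness of [K]: the balls of centre [p.2] and radius
   [normV (p.1 - v0)] meet pairwise, hence have a common point, obtained as a
   limit of centres of balls whose radii tend to the infimum. *)
Lemma ball_center (A : set (V * K)) (v0 : V) : A !=set0 ->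
  (forall p q, A p -> A q -> absK (p.2 - q.2) <= normV (p.1 - q.1)) ->
  exists k, forall p, A p -> absK (p.2 - k) <= normV (p.1 - v0).
Proof.
move=> [p0 Ap0] hAd.
pose D := [set normV (p.1 - v0) | p in A].
have infD : has_inf D.
  split; first by exists (normV (p0.1 - v0)), p0.
  by exists 0 => _ [p _ <-]; exact: (norm_ge0 hN).
have /choice[p hp] : forall n : nat, exists p, A p /\ normV (p.1 - v0) < inf D + n.+1%:R^-1.
  move=> n; have [|_ [p Ap <-] h] := @inf_adherent _ _ n.+1%:R^-1 _ infD.
    by rewrite invr_gt0 ltr0n.
  by exists p.
(* All radii in the sequence are at most [inf D + 1], which by the ultrametric inequality bounds the
   distance from each centre to the first one. *)
have pB n : absK (p n).2 <= Num.max (absK (p 0%N).2) (inf D + 1).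
  rewrite -(subrK (p 0%N).2 (p n).2).
  apply: (absD_le hA); rewrite le_max ?lexx //; apply/orP; right.
  apply: le_trans (hAd _ _ (hp n).1 (hp 0%N).1) _.
  apply: (norm_dist_le hN (y := v0)); rewrite 1?(normBC hA hN v0).
    apply: le_trans (ltW (hp n).2) _; rewrite lerD2l.
    by rewrite invf_le1 ?ltr0n // ler1n.
  by apply: le_trans (ltW (hp 0%N).2) _; rewrite invr1.
have [phi hphi [l hl]] := bounded_subseq hK pB.
have phi_ge n : (n <= phi n)%N.
  by elim: n => // n ih; exact: leq_ltn_trans (hphi n).
exists l => q Aq; rewrite leNgt; apply/negP => hq.
have [N hN'] := hl (absK (q.2 - l)) (le_lt_trans (norm_ge0 hN _) hq).
(* The supposed excess of the distance over the radius. A late centre of radius below [inf D + e] is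
   closer than [absK (q.2 - l)] to both [q.2] and [l], which is absurd. *)
set e := absK (q.2 - l) - normV (q.1 - v0).
have e0 : 0 < e by rewrite subr_gt0.
pose n := maxn N (Num.bound e^-1).
have pn : normV ((p (phi n)).1 - v0) < absK (q.2 - l).
  apply: lt_trans (hp (phi n)).2 _.
  rewrite -[ltRHS](subrK (normV (q.1 - v0))) addrC -/e; apply: ltr_leD.
    by rewrite invS_lt_eps // (leq_trans _ (phi_ge n)) // leq_maxr.
  by apply: ge_inf; [case: infD|exists q].
have : absK (q.2 - l) < absK (q.2 - l).
  apply: (abs_dist_lt hA (y := (p (phi n)).2)); last by apply: hN'; exact: leq_maxl.
  apply: le_lt_trans (hAd _ _ Aq (hp _).1) _.
  by apply: (norm_dist_lt hN (y := v0)) => //; rewrite (normBC hA hN).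
by rewrite ltxx.
Qed.

(** Partial functionals are handled as graphs, so that a chain has its plain union as upper bound; a
    graph that is linear and contractive is automatically single-valued. *)
Let linear_graph (A : set (V * K)) :=
  forall a p q, A p -> A q -> A (a *: p.1 + q.1, a * p.2 + q.2).
Let contractive_graph (A : set (V * K)) := forall p, A p -> absK p.2 <= normV p.1.

Let graph_dist (A : set (V * K)) : linear_graph A -> contractive_graph A ->
  forall p q, A p -> A q -> absK (p.2 - q.2) <= normV (p.1 - q.1).
Proof.
move=> lA cA p q Ap Aq; have := cA _ (lA (-1) q p Aq Ap).
by rewrite /= scaleN1r mulN1r ![- _ + _]addrC.
Qed.

(** Zorn's lemma gives a maximal contractive graph; [ball_center] supplies an admissible value at
    any vector missing from its domain. *)
Lemma hahn_banach (x0 : V) (t0 : K) : x0 != 0 -> absK t0 <= normV x0 ->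
  exists T : V -> K,
  [/\ (forall a x y, T (a *: x + y) = a * T x + T y),
      (forall x, absK (T x) <= normV x) & T x0 = t0].
Proof.
move=> x00 t0x0.
(* The last condition is conditional so that the empty set, the union of the empty chain, satisfies
   it. *)
pose P : set (set (V * K)) := [set A |
  [/\ linear_graph A, contractive_graph A & forall p, A p -> A (x0, t0)]].
have [F FP Ftot|A [[lA cA A0] maxA]] := @Zorn_bigcup _ P.
  split=> [a p q [B FB Bp] [C FC Cq]|p [B FB Bp]|p [B FB Bp]].
  - have [BC|CB] := Ftot _ _ FB FC.
      by exists C => //; have [h _ _] := FP _ FC; apply: h => //; exact: BC.
    by exists B => //; have [h _ _] := FP _ FB; apply: h => //; exact: CB.
  - by have [_ h _] := FP _ FB; exact: h.
  - by exists B => //; have [_ _ h] := FP _ FB; exact: h Bp.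
have Ax0 : A (x0, t0).
  apply: contrapT => nA; apply: (maxA [set p | exists a, p = (a *: x0, a * t0)]).
    split=> [p /A0 //|h]; apply: nA; apply: h.
    by exists 1; rewrite scale1r mul1r.
  split=> [a _ _ [b ->] [c ->]|_ [a ->]|_ _] /=.
  - by exists (a * b + c); rewrite scalerDl mulrDl scalerA mulrA.
  - by rewrite (normZ hN) (absM hA) ler_wpM2l // (abs_ge0 hA).
  - by exists 1; rewrite scale1r mul1r.
have A00 : A (0, 0).
  by have := lA (-1) _ _ Ax0 Ax0; rewrite /= scaleN1r mulN1r !addNr.
have dom v0 : exists k, A (v0, k).
  apply: contrapT => nA.
  have [k hk] := ball_center v0 (ex_intro _ _ A00) (graph_dist lA cA).
  apply: (maxA [set z | exists p a, A p /\ z = (p.1 + a *: v0, p.2 + a * k)]).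
    split=> [p Ap|h].
      by exists p, 0; split=> //; rewrite scale0r mul0r !addr0 -surjective_pairing.
    apply: nA; exists k; apply: h; exists (0, 0), 1; split=> //=.
    by rewrite scale1r mul1r !add0r.
  split=> [a _ _ [p [b [Ap ->]]] [q [c [Aq ->]]]|_ [p [a [Ap ->]]]|_ _] /=.
  - exists (a *: p.1 + q.1, a * p.2 + q.2), (a * b + c); split; first exact: lA.
    rewrite /=; congr pair; first by rewrite scalerDr scalerA addrACA -scalerDl.
    by rewrite mulrDr mulrA addrACA -mulrDl.
  - have [->|a0] := eqVneq a 0; first by rewrite scale0r mul0r !addr0; exact: cA.
    (* The bound at [p.1 + a *: v0] is the one given by [k] at [- a^-1 *: p.1], multiplied by
       [absK a]. *)
    have := hk _ (lA (- a^-1) _ _ Ap A00).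
    rewrite /= !addr0 -[_ - k]opprK -[_ - v0]opprK (absN hA) (normN hA hN).
    rewrite !opprB mulNr scaleNr !opprK => h.
    have -> : p.1 + a *: v0 = a *: (v0 + a^-1 *: p.1).
      by rewrite scalerDr scalerA mulfV // scale1r addrC.
    have -> : p.2 + a * k = a * (k + a^-1 * p.2).
      by rewrite mulrDr mulrA mulfV // mul1r addrC.
    by rewrite (normZ hN) (absM hA) ler_wpM2l // (abs_ge0 hA).
  - by exists (x0, t0), 0; split=> //=; rewrite scale0r mul0r !addr0.
have funA v k k' : A (v, k) -> A (v, k') -> k = k'.
  move=> h h'; have := graph_dist lA cA h h'.
  rewrite /= subrr (norm0 hN) => kk; apply/eqP; rewrite -subr_eq0 -(abs_eq0 hA).
  by rewrite eq_le kk (abs_ge0 hA).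
have [T hT] := choice dom.
exists T; split=> [a x y|x|]; last exact: funA Ax0.
  by apply: funA (hT _) _; exact: lA (hT x) (hT y).
exact: cA (hT x).
Qed.

(** A norm need not be a value of [absK], but it is one up to a factor [absK t]: take the first
    power of [t], counted from a negative one, whose value is at most [s]. *)
Lemma abs_value_between (s : R) : 0 < s ->
  forall t, 0 < absK t < 1 -> exists y, absK t * s <= absK y <= s.
Proof.
move=> s0 t /andP[t0 t1].
have [m hm] : exists m, absK t ^+ m < s^-1.
  by apply: expr_lt_eps; rewrite ?invr_gt0 // ltW.
have sm : s < absK (t ^- m).
  by rewrite (absV hA) (absX hA) -[s]invrK ltf_pV2 // posrE ?exprn_gt0 ?invr_gt0.
have tm0 : 0 < absK (t ^- m) := lt_trans s0 sm.
have ex : exists j, absK t ^+ j * absK (t ^- m) <= s.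
  have [j hj] : exists j, absK t ^+ j < s / absK (t ^- m).
    by apply: expr_lt_eps; rewrite ?divr_gt0 // ltW.
  by exists j; rewrite -ler_pdivlMr // ltW.
case: (ex_minnP ex) => -[|j] hj jmin; first by rewrite mul1r leNgt sm in hj.
exists (t ^+ j.+1 * t ^- m); rewrite (absM hA) (absX hA) hj andbT exprS -mulrA.
rewrite ler_pM2l // leNgt; apply/negP => /ltW /jmin.
by rewrite ltnn.
Qed.

(** A form nearly norming at [u n] is nearly norming at every nonzero [x] with
    [normV (x - u n) < absK t * normV x]: there the norms of [x] and [u n] agree, and so do the
    absolute values of the form. *)
Lemma norming_functionals (u : nat -> V) :
  (forall x (e : R), 0 < e -> exists n, normV (x - u n) < e) ->
  exists (T : nat -> V -> K) (c : R),
  [/\ 0 < c, (forall n a x y, T n (a *: x + y) = a * T n x + T n y),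
      (forall n x, absK (T n x) <= normV x) &
      (forall x, exists n, c * normV x <= absK (T n x))].
Proof.
move=> ud; have [_ [t t01] _] := hK; have /andP[t0 t1] := t01.
have hT n : exists T : V -> K, 
  [/\ (forall a x y, T (a *: x + y) = a * T x + T y),
      (forall x, absK (T x) <= normV x) & absK t * normV (u n) <= absK (T (u n))].
  have [u0|u0] := eqVneq (u n) 0.
    exists (fun=> 0); split=> [*|x|]; first by rewrite mulr0 addr0.
      by rewrite (abs0 hA) (norm_ge0 hN).
    by rewrite u0 (norm0 hN) mulr0 (abs0 hA).
  have [|y /andP[y1 y2]] := @abs_value_between (normV (u n)) _ t t01.
    by rewrite (norm_gt0 hN).
  by have [T [h1 h2 h3]] := hahn_banach u0 y2; exists T; split=> //; rewrite h3.
have [T {}hT] := choice hT.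
exists T, (absK t); split=> //; first by move=> n; case: (hT n).
  by move=> n; case: (hT n).
move=> x; have [->|x0] := eqVneq x 0.
  by exists 0%N; rewrite (norm0 hN) mulr0 (abs_ge0 hA).
have nx : 0 < normV x by rewrite (norm_gt0 hN).
have [n hn] := ud x _ (mulr_gt0 t0 nx).
have [lT cT uT] := hT n.
have un : normV (u n) = normV x.
  by apply: (norm_close hA hN); apply: lt_trans hn _; rewrite gtr_pMl.
exists n; rewrite -{1}un (le_trans uT) //.
rewrite leNgt; apply/negP => h.
suff e : absK (T n (u n) - T n x) < absK (T n (u n)).
  by move: h; rewrite (abs_close hA e) ltxx.
have -> : T n (u n) - T n x = T n (u n - x).
  by have := lT (-1) x (u n); rewrite mulN1r scaleN1r ![- _ + _]addrC.
apply: le_lt_trans (cT _) _; rewrite (normBC hA hN).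
by apply: lt_le_trans hn _; rewrite -un.
Qed.

End HahnBanach.

(** * Averaging over slabs *)

Section Averaging.
Context {R : realType} {K : fieldType} {absK : K -> R}.
Hypothesis hK : local_field absK.
Let hA : nonarch_abs absK. Proof. by case: hK. Qed.

Lemma abs_sum_le (I : Type) (s : seq I) (Q : pred I) (f : I -> K) (r : R) :
  0 <= r -> (forall i, Q i -> absK (f i) <= r) -> absK (\sum_(i <- s | Q i) f i) <= r.
Proof.
move=> r0 h; apply: (big_ind (fun z => absK z <= r)) => //; first by rewrite (abs0 hA).
by move=> *; exact: (absD_le hA).
Qed.

Lemma abs_sum_lt (I : Type) (s : seq I) (Q : pred I) (f : I -> K) (r : R) :
  0 < r -> (forall i, Q i -> absK (f i) < r) -> absK (\sum_(i <- s | Q i) f i) < r.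
Proof.
move=> r0 h; apply: (big_ind (fun z => absK z < r)) => //; first by rewrite (abs0 hA).
by move=> *; exact: (absD_lt hA).
Qed.

(* Cutting the slab [|x.e| <= |p|] into [q] translates of [|x.e| < |p|], where
   [q] is the order of the residue field: on average over [e] in the unit ball
   they have the same weight unless all [x k] lie in the ball [|.| < |p|].  The
   average runs over representatives [e] modulo a small ball, which does not
   affect the slabs as long as [x] is bounded. *)
Lemma residue_averaging (n : nat) (p : K) (B : R) : p != 0 ->
  exists (q : nat) (I : finType) (e : I -> 'I_n -> K),
  [/\ (1 < q)%N, (0 < #|I|)%N, (forall i k, absK (e i k) <= 1) &
   forall x : 'I_n -> K, (forall k, absK (x k) <= B) ->
   (q * \sum_(i : I) (absK (\sum_k e i k * x k) < absK p)%R
    = \sum_(i : I) (absK (\sum_k e i k * x k) <= absK p)%R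
      + (q.-1 * #|I|) * [forall k, absK (x k) < absK p]%R)%N].
Proof.
move=> p0; have ap0 : 0 < absK p by rewrite (abs_gt0 hA).
have [F1 [rep1 [uF1 F1P rep1P rep1E]]] := finite_reps hK ltr01 (lexx 1).
(* A change of a coefficient by less than [eps] moves the sum by less than [absK p] when the entries
   of [x] are bounded by [B]. *)
pose eps := Num.min 1 (absK p / (`|B| + 1)).
have B1 : 0 < `|B| + 1 by rewrite ltr_wpDl.
have eps0 : 0 < eps by rewrite lt_min ltr01 divr_gt0.
have eps1 : eps <= 1 by rewrite ge_min lexx.
have epsB (z : K) : absK z <= B -> eps * absK z <= absK p.
  move=> zB; apply: le_trans (_ : eps * (`|B| + 1) <= _).
    rewrite ler_wpM2l ?(ltW eps0) // (le_trans zB) // (le_trans (ler_norm B)) //.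
    by rewrite lerDl.
  by rewrite -ler_pdivlMr // ge_min lexx orbT.
have [F [rep [uF FP repP repE]]] := finite_reps hK eps0 eps1.
have abs0_le1 : absK 0 <= 1 by rewrite (abs0 hA).
have abs1_le1 : absK 1 <= 1 by rewrite (abs1 hA).
have q1 : (1 < size F1)%N.
  have [r0 h0] := rep1P _ abs0_le1; have [r1 h1] := rep1P _ abs1_le1.
  have r01 : rep1 0 != rep1 1.
    apply/eqP => h; rewrite h in h0; rewrite (absBC hA) in h1.
    by have := abs_dist_lt hA h0 h1; rewrite sub0r (absN hA) (abs1 hA) ltxx.
  apply: (@uniq_leq_size _ [:: rep1 0; rep1 1]) => [|z]; first by rewrite /= inE r01.
  by rewrite !inE => /orP[] /eqP->.
pose I := {ffun 'I_n -> seq_sub F}.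
exists (size F1), I, (fun (i : I) k => val (i k)); split=> //.
- by apply/card_gt0P; exists [ffun=> SeqSub (repP _ abs0_le1).1].
- by move=> i k; have [] := FP _ (valP (i k)).
move=> x xB; pose s (i : I) := \sum_k val (i k) * x k.
have [hx|] := boolP [forall k, absK (x k) < absK p].
  have hs i : absK (s i) < absK p.
    apply: abs_sum_lt => // k _; rewrite (absM hA).
    have [i1 _] := FP _ (valP (i k)).
    by apply: le_lt_trans (forallP hx k); rewrite ler_piMl // (abs_ge0 hA).
  under eq_bigr do rewrite hs.
  under [in RHS]eq_bigr do rewrite (ltW (hs _)).
  by rewrite !sum1_card muln1 -mulSn prednK // ltnW.
rewrite negb_forall => /existsP[j]; rewrite -leNgt => hj; rewrite muln0 addn0.
have xj0 : x j != 0 by rewrite -(abs_gt0 hA) (lt_le_trans ap0).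
have y1 : absK (p / x j) <= 1.
  by rewrite (absM hA) (absV hA) ler_pdivrMr ?mul1r // (lt_le_trans ap0).
(* The closed slab is the disjoint union of the translates of the open one by [t * p], where [t]
   runs over representatives of the residue field. *)
have cut i : (absK (s i) <= absK p)%R = (\sum_(t <- F1) (absK (s i - t * p) < absK p)%R)%N :> nat.
  have [si|si] := boolP (absK (s i) <= absK p); last first.
    rewrite big_seq big1 // => t tF; apply/eqP; rewrite eqb0; apply: contra si => h.
    rewrite -(subrK (t * p) (s i)); apply: (absD_le hA); first exact: ltW.
    by rewrite (absM hA) ler_piMl ?(abs_ge0 hA) //; have [] := F1P _ tF.
  have si1 : absK (s i / p) <= 1 by rewrite (absM hA) (absV hA) ler_pdivrMr // mul1r.
  have [rF rs] := rep1P _ si1.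
  rewrite big_seq (eq_bigr (fun t => nat_of_bool (t == rep1 (s i / p)))) => [|t tF].
    rewrite -big_seq; transitivity (\sum_(t <- F1 | t == rep1 (s i / p)) 1)%N.
      by rewrite sum1_count count_uniq_mem // rF.
    by rewrite big_mkcond; apply: eq_bigr => t _ /=; case: (t == _).
  congr nat_of_bool.
  have -> : s i - t * p = (s i / p - t) * p by rewrite mulrBl divfK.
  rewrite (absM hA) gtr_pMl //; apply/idP/eqP => [/rep1E->|->//].
  by have [_ ->] := F1P _ tF.
under [in RHS]eq_bigr do rewrite cut.
rewrite exchange_big /= -sum1_size big_distrl /=; apply: eq_big_seq => t tF.
rewrite mul1n; have [t1 _] := F1P _ tF.
(* Adding [z] to the [j]-th coefficient moves the sum by [t * p]; since [x j] is at least as large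
   as [p], [z] stays in the unit ball. Followed by [rep], this shift permutes the finite index set,
   so every translate has the same count. *)
pose z := t * (p / x j).
have z1 : absK z <= 1 by rewrite (absM hA) mulr_ile1 // (abs_ge0 hA).
have shF (a : seq_sub F) : rep (val a + z) \in F /\ absK (val a + z - rep (val a + z)) < eps.
  by apply: repP; apply: (absD_le hA) => //; have [] := FP _ (valP a).
pose g (i : I) :=
  [ffun k => if k == j then insubd (i k) (rep (val (i k) + z)) else i k].
have gE i k : val (g i k) = if k == j then rep (val (i k) + z) else val (i k).
  by rewrite ffunE; case: eqP => // _; rewrite val_insubd (shF _).1.
have g_inj : injective g.
  move=> i i' h; apply/ffunP => k; apply: val_inj.
  have := gE i k; rewrite h gE; case: eqP => // _ h'.
  have [_ hi] := FP _ (valP (i k)); have [_ hi'] := FP _ (valP (i' k)).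
  rewrite -hi -hi'; apply: repE.
  have -> : val (i k) - val (i' k) = (val (i k) + z) - (val (i' k) + z).
    by rewrite opprD addrACA subrr addr0.
  apply: (abs_dist_lt hA (y := rep (val (i k) + z))); first exact: (shF _).2.
  by rewrite -h' (absBC hA); exact: (shF _).2.
rewrite [RHS](reindex_inj g_inj); apply: eq_bigr => i _; congr nat_of_bool.
have sg : absK (s (g i) - t * p - s i) < absK p.
  have -> : s (g i) - t * p - s i = (rep (val (i j) + z) - (val (i j) + z)) * x j.
    rewrite /s (bigD1 j) //= [in X in _ - X](bigD1 j) //= gE eqxx.
    rewrite (eq_bigr (fun k => val (i k) * x k)) => [|k /negPf kj]; last by rewrite gE kj.
    set w := \sum_(_ | _) _; have -> : t * p = z * x j by rewrite /z -!mulrA mulVf ?mulr1.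
    by rewrite mulrBl mulrDl; ring.
  rewrite (absM hA) (absBC hA); apply: lt_le_trans (epsB _ (xB j)).
  by rewrite ltr_pM2r ?(lt_le_trans ap0) //; exact: (shF _).2.
apply/idP/idP => h.
  by rewrite -(subrK (s i) (s (g i) - _)); apply: (absD_lt hA).
rewrite -[X in absK X](subKr (s (g i) - t * p)); exact: (absB_lt hA).
Qed.

End Averaging.

(** * Borel sets and pairs of random variables *)

Lemma mborel_sigma {R : realType} {S : Type} (dist : S -> S -> R) :
  sigma_algebra setT (mborel dist).
Proof. exact: smallest_sigma_algebra. Qed.

Lemma mborel_open {R : realType} {S : Type} (dist : S -> S -> R) (U : set S) :
  mopen dist U -> mborel dist U.
Proof. by move=> oU; apply: sub_gen_smallest. Qed.

Lemma mborel_preimage {R : realType} {S S' : Type} (dist : S -> S -> R)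
    (dist' : S' -> S' -> R) (f : S -> S') :
  (forall x (e : R), 0 < e ->
    exists2 d : R, 0 < d & forall y, dist x y < d -> dist' (f x) (f y) < e) ->
  forall A, mborel dist' A -> mborel dist (f @^-1` A).
Proof.
move=> cf; have [s0 sC sU] := mborel_sigma dist.
apply: (@smallest_sub _ (@sigma_algebra S' setT) _
  [set A | mborel dist (f @^-1` A)]) => [|U oU] /=.
  split=> [|A hA|F hF] /=; first by rewrite preimage_set0.
    by rewrite setTD preimage_setC -setTD; exact: sC.
  by rewrite preimage_bigcup; exact: sU.
apply: mborel_open => x Ux; have [e e0 he] := oU _ Ux.
by have [d d0 hd] := cf x e e0; exists d => // y /hd; exact: he.
Qed.

(** Each sum of probabilities is the integral of the function counting the events that occur. *)
Lemma count_probability {R : realType} {d} {O : measurableType d}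
    (P : probability O R) (I J : finType) (A : I -> set O) (B : J -> set O) :
  (forall i, measurable (A i)) -> (forall j, measurable (B j)) ->
  {ae P, forall w, (\sum_i (w \in A i) = \sum_j (w \in B j))%N} ->
  (\sum_i P (A i) = \sum_j P (B j))%E.
Proof.
move=> mA mB h.
have count_int (H : finType) (F : H -> set O) : (forall i, measurable (F i)) ->
    (\sum_i P (F i) = \int[P]_w (\sum_i (\1_(F i) w)%:E))%E.
  move=> mF; rewrite ge0_integral_sum //.
  - by apply: eq_bigr => i _; rewrite integral_indic // setIT.
  - by move=> i; apply/measurable_EFinP; exact: measurable_indic.
rewrite !count_int //; apply: ae_eq_integral => //.
- by apply: emeasurable_sum => i; apply/measurable_EFinP; exact: measurable_indic.
- by apply: emeasurable_sum => i; apply/measurable_EFinP; exact: measurable_indic.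
apply: filterS h => w hw _; rewrite !sumEFin; congr EFin.
under eq_bigr do rewrite indicE; under [RHS]eq_bigr do rewrite indicE.
by rewrite -!natr_sum hw.
Qed.

Section ProductProbability.
Context {R : realType} {d1 d2} {O1 : measurableType d1} {O2 : measurableType d2}.
Variables (P1 : probability O1 R) (P2 : probability O2 R).

(** Named to carry a probability structure; it provides two independent copies of a given random
    variable. *)
Definition prod_prob : set (O1 * O2) -> \bar R := (P1 \x P2)%E.

HB.instance Definition _ := Measure.on prod_prob.

Let prod_prob_setT : prod_prob setT = 1%E.
Proof.
rewrite -setXTT; transitivity (P1 setT * P2 setT)%E.
  exact: product_measure1E.
by rewrite !probability_setT mule1.
Qed.

HB.instance Definition _ := Measure_isProbability.Build _ _ _ prod_prob prod_prob_setT.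

Lemma prod_probX A B : measurable A -> measurable B ->
  prod_prob (A `*` B) = (P1 A * P2 B)%E.
Proof. exact: product_measure1E. Qed.

End ProductProbability.

Section Pairs.
Context {R : realType} {K : fieldType} {absK : K -> R}.
Hypothesis hA : nonarch_abs absK.
Context {V : lmodType K} {normV : V -> R}.
Hypothesis hN : nonarch_norm absK normV.
Context {u : nat -> V}.
Hypothesis ud : forall x (e : R), 0 < e -> exists n, normV (x - u n) < e.

Definition pair_seq (n : nat) : V * V :=
  if unpickle n is Some (i, j) then (u i, u j) else (u 0%N, u 0%N).

Lemma pair_seq_dense (p : V * V) (e : R) : 0 < e ->
  exists n, pdist normV (pair_seq n) p < e.
Proof.
move=> e0; have [i hi] := ud p.1 e0; have [j hj] := ud p.2 e0.
exists (pickle (i, j)); rewrite /pair_seq pickleK /pdist /= gt_max.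
by rewrite !(normBC hA hN (u _)) hi.
Qed.

Lemma open_ball (c : V) (e : R) : mopen (ndist normV) [set y | normV (c - y) < e].
Proof.
move=> x /= hx; exists e; first exact: le_lt_trans (norm_ge0 hN _) hx.
by move=> y; exact: (norm_dist_lt hN).
Qed.

(** Balls of the maximum metric are products of balls, so independence and the marginals determine
    the law of a pair. *)
Lemma indep_pair_agree
    {d1} {O1 : measurableType d1} (P1 : probability O1 R) (X1 Y1 : O1 -> V)
    {d2} {O2 : measurableType d2} (P2 : probability O2 R) (X2 Y2 : O2 -> V) :
  random_var normV X1 -> random_var normV Y1 ->
  random_var normV X2 -> random_var normV Y2 ->
  same_law normV P1 X1 P2 X2 -> same_law normV P1 Y1 P2 Y2 ->
  indep2 normV P1 X1 Y1 -> indep2 normV P2 X2 Y2 ->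
  forall B, mborel (pdist normV) B ->
    prob_agree P1 (fun w => (X1 w, Y1 w)) P2 (fun w => (X2 w, Y2 w)) B.
Proof.
move=> mX1 mY1 mX2 mY2 eX eY i1 i2.
pose r (m : nat) p q := pdist normV p q < m.+1%:R^-1.
have pB p q (e : R) : (pdist normV p q < e) =
    (normV (p.1 - q.1) < e) && (normV (p.2 - q.2) < e) by rewrite /pdist gt_max.
apply: (@prob_agree_classes _ _ _ r pair_seq).
- by move=> m x y; rewrite /r !pB (normBC hA hN x.1) (normBC hA hN x.2).
- move=> m x y z; rewrite /r !pB => /andP[h1 h2] /andP[h3 h4].
  by apply/andP; split; [exact: (norm_dist_lt hN h1)|exact: (norm_dist_lt hN h2)].
- move=> m n x y mn h; apply: lt_le_trans h _.
  by rewrite lef_pV2 ?posrE ?ltr0n // ler_nat.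
- by move=> m x; apply: pair_seq_dense; rewrite invr_gt0 ltr0n.
- move=> e e0; exists (Num.bound e^-1) => x y h; apply: lt_trans h _.
  exact: invS_lt_eps.
move=> m p; pose D c : set V := [set y | normV (c - y) < m.+1%:R^-1].
have bD c : mborel (ndist normV) (D c) by apply: mborel_open; exact: open_ball.
have E (O : Type) (X Y : O -> V) :
    (fun w => (X w, Y w)) @^-1` [set q | r m p q] = X @^-1` D p.1 `&` Y @^-1` D p.2.
  by apply/seteqP; split=> w; rewrite /= /r pB => /andP.
split; rewrite !E.
- by apply: measurableI; [exact: (mX1 _ (bD _))|exact: (mY1 _ (bD _))].
- by apply: measurableI; [exact: (mX2 _ (bD _))|exact: (mY2 _ (bD _))].
rewrite i1; [|exact: bD|exact: bD]; rewrite i2; [|exact: bD|exact: bD].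
by rewrite eX; [rewrite eY; [by []|exact: bD]|exact: bD].
Qed.

End Pairs.

(** * Images of Gaussian laws *)

Section LinearForm.
Context {K : fieldType} {V : lmodType K} {T : V -> K}.
Hypothesis lT : forall a x y, T (a *: x + y) = a * T x + T y.

Lemma form0 : T 0 = 0.
Proof.
by have := lT 1 0 0; rewrite scaler0 addr0 mul1r => /eqP; rewrite -subr_eq subrr => /eqP.
Qed.

Lemma formZ a x : T (a *: x) = a * T x.
Proof. by have := lT a x 0; rewrite !addr0 form0 addr0. Qed.

Lemma formB x y : T (x - y) = T x - T y.
Proof. by have := lT (-1) y x; rewrite scaleN1r mulN1r ![- _ + _]addrC. Qed.

End LinearForm.

(** * Orthonormal pairs in the plane over [K] *)

Section Orthonormal.
Context {R : realType} {K : fieldType} {absK : K -> R}.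
Hypothesis hA : nonarch_abs absK.
Implicit Types a b : K * K.

Lemma norm2_eq1 a : norm2 absK a = 1 -> absK a.1 <= 1 /\ absK a.2 <= 1.
Proof. by rewrite /norm2 => <-; rewrite !le_max !lexx orbT. Qed.

(** Testing orthogonality on the combinations of [a] and [b] equal to [(D, 0)] and [(0, - D)] bounds
    both entries of [a] by [absK D], and one of them has absolute value 1. *)
Lemma orthonormal2_det a b : orthonormal2 absK a b -> absK (a.1 * b.2 - a.2 * b.1) = 1.
Proof.
move=> [a1 b1 h]; have [a11 a12] := norm2_eq1 a1; have [b11 b12] := norm2_eq1 b1.
set D := a.1 * b.2 - a.2 * b.1.
have D1 : absK D <= 1.
  by apply: (absB_le hA); rewrite (absM hA) mulr_ile1 // (abs_ge0 hA).
have e1 : b.2 * a.1 + - a.2 * b.1 = D by rewrite /D mulNr [b.2 * _]mulrC.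
have e2 : b.2 * a.2 + - a.2 * b.2 = 0 by rewrite mulNr mulrC subrr.
have e3 : b.1 * a.1 + - a.1 * b.1 = 0 by rewrite mulNr mulrC subrr.
have e4 : b.1 * a.2 + - a.1 * b.2 = - D by rewrite /D opprB mulNr [b.1 * _]mulrC.
have aD2 : absK a.2 <= absK D.
  have := h b.2 (- a.2); rewrite e1 e2 a1 b1 !mulr1 !(absN hA) /norm2 /= (abs0 hA).
  by rewrite [LHS]max_l ?(abs_ge0 hA) // => ->; rewrite le_max lexx orbT.
have aD1 : absK a.1 <= absK D.
  have := h b.1 (- a.1); rewrite e3 e4 a1 b1 !mulr1 !(absN hA) /norm2 /= (abs0 hA).
  by rewrite [LHS]max_r ?(abs_ge0 hA) // absN // => ->; rewrite le_max lexx orbT.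
apply/eqP; rewrite eq_le D1 /=; apply: le_trans (_ : norm2 absK a <= _).
  by rewrite a1.
by rewrite ge_max aD1 aD2.
Qed.

Lemma orthonormal2_shear u : absK u <= 1 -> orthonormal2 absK (1, u) (0, 1).
Proof.
move=> u1; have e1 : norm2 absK (1, u) = 1 by rewrite /norm2 /= (abs1 hA) max_l.
have e2 : norm2 absK (0, 1) = 1 by rewrite /norm2 /= (abs1 hA) (abs0 hA) max_r.
split=> // al be; rewrite e1 e2 /norm2 /= !mulr1 mulr0 addr0.
have uu : absK (al * u) <= absK al by rewrite (absM hA) ler_piMr ?(abs_ge0 hA).
have h1 : absK (al * u + be) <= Num.max (absK al) (absK be).
  by apply: (absD_le hA); rewrite le_max ?uu ?lexx ?orbT.
have h2 : absK be <= Num.max (absK al) (absK (al * u + be)).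
  rewrite -[X in absK X <= _](addKr (al * u)) addrC.
  by apply: (absB_le hA); rewrite le_max ?uu ?lexx ?orbT.
by apply/eqP; rewrite eq_le !ge_max h1 h2 !le_max !lexx.
Qed.

Context {V : lmodType K} {normV : V -> R}.
Hypothesis hN : nonarch_norm absK normV.

Lemma normZ_le (a : K) (x : V) : absK a <= 1 -> normV (a *: x) <= normV x.
Proof. by move=> a1; rewrite (normZ hN) ler_piMl // (norm_ge0 hN). Qed.

(** The coefficients lie in the unit ball, so the map does not increase distances. *)
Lemma mborel_orthonormal a b : orthonormal2 absK a b ->
  forall B, mborel (pdist normV) B ->
  mborel (pdist normV)
    ((fun q : V * V => (a.1 *: q.1 + a.2 *: q.2, b.1 *: q.1 + b.2 *: q.2)) @^-1` B).
Proof.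
move=> [/norm2_eq1[a1 a2] /norm2_eq1[b1 b2] _]; apply: mborel_preimage => x e e0.
exists e => // y; rewrite /pdist /= !gt_max => /andP[h1 h2].
have comb c c' : absK c <= 1 -> absK c' <= 1 ->
    normV (c *: x.1 + c' *: x.2 - (c *: y.1 + c' *: y.2)) < e.
  move=> c1 c'1; rewrite opprD addrACA -!scalerBr; apply: (normD_lt hN).
    exact: le_lt_trans (normZ_le _ c1) h1.
  exact: le_lt_trans (normZ_le _ c'1) h2.
by rewrite !comb.
Qed.

End Orthonormal.

Section Functional.
Context {R : realType} {K : fieldType} {absK : K -> R}.
Context {V : lmodType K} {normV : V -> R} {T : V -> K}.
Hypothesis dT : dual_elem absK normV T.

Lemma mborel_dual A : mborel (ndist (absK : K^o -> R)) A -> mborel (ndist normV) (T @^-1` A).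
Proof. by case: dT => _ cT; apply: mborel_preimage => x e e0; exact: cT. Qed.

Lemma mborel_dual_pair (A : set (K^o * K^o)) : mborel (pdist (absK : K^o -> R)) A ->
  mborel (pdist normV) ((fun q => (T q.1, T q.2)) @^-1` A).
Proof.
case: dT => _ cT; apply: mborel_preimage => x e e0.
have [d1 d10 h1] := cT x.1 e e0; have [d2 d20 h2] := cT x.2 e e0.
exists (Num.min d1 d2); first by rewrite lt_min d10.
move=> y; rewrite /pdist /= !gt_max !lt_min => /andP[/andP[? ?] /andP[? ?]].
by rewrite h1 // h2.
Qed.

Lemma random_var_dual {d} {O : measurableType d} (X : O -> V) :
  random_var normV X -> random_var (absK : K^o -> R) (fun w => T (X w) : K^o).
Proof. by move=> mX A hA; have := mX _ (mborel_dual hA). Qed.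

Lemma same_law_dual {d1} {O1 : measurableType d1} (P1 : probability O1 R) (X1 : O1 -> V)
    {d2} {O2 : measurableType d2} (P2 : probability O2 R) (X2 : O2 -> V) :
  same_law normV P1 X1 P2 X2 ->
  same_law (absK : K^o -> R) P1 (fun w => T (X1 w) : K^o) P2 (fun w => T (X2 w) : K^o).
Proof. by move=> eX A hA; have := eX _ (mborel_dual hA). Qed.

Lemma indep2_dual {d} {O : measurableType d} (P : probability O R) (X Y : O -> V) :
  indep2 normV P X Y ->
  indep2 (absK : K^o -> R) P (fun w => T (X w) : K^o) (fun w => T (Y w) : K^o).
Proof. by move=> iXY A B hA hB; have := iXY _ _ (mborel_dual hA) (mborel_dual hB). Qed.

End Functional.

(** Given copies of [T(X)] need not come from copies of [X] on their space. Independent copies of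
    [X] are built on the product space instead, and their images under [T] have the same joint law
    as the given pair. *)
Lemma KGaussian_dual {R : realType} {K : fieldType} {absK : K -> R}
    {V : lmodType K} {normV : V -> R} {d} {O : measurableType d} (P : probability O R)
    (X : O -> V) (T : V -> K) :
  local_field absK -> random_var normV X -> dual_elem absK normV T ->
  KGaussian absK normV P X ->
  KGaussian absK (absK : K^o -> R) P (fun w => T (X w) : K^o).
Proof.
move=> hK mX dT gX d' O' P' Y1 Y2 mY1 mY2 eY1 eY2 iY a b oab B mB.
have [hA _ _] := hK; have hN := abs_nonarch_norm hA.
have [u ud] := local_field_separable hK.
pose Q : probability (O * O)%type R := prod_prob P P.
have QX A A' : measurable A -> measurable A' -> Q (A `*` A') = (P A * P A')%E.
  exact: prod_probX.
pose X1 (w : O * O) := X w.1; pose X2 (w : O * O) := X w.2.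
have E1 A : X1 @^-1` A = (X @^-1` A) `*` setT by apply/seteqP; split=> w // [].
have E2 A : X2 @^-1` A = setT `*` (X @^-1` A) by apply/seteqP; split=> w // [].
have mX1 : random_var normV X1.
  by move=> A hA'; rewrite E1; apply: measurableX => //; exact: mX.
have mX2 : random_var normV X2.
  by move=> A hA'; rewrite E2; apply: measurableX => //; exact: mX.
have eX1 : same_law normV Q X1 P X.
  move=> A hA'; rewrite E1 QX //; last exact: mX.
  by rewrite probability_setT mule1.
have eX2 : same_law normV Q X2 P X.
  move=> A hA'; rewrite E2 QX //; last exact: mX.
  by rewrite probability_setT mul1e.
have iX : indep2 normV Q X1 X2.
  move=> A A' hA1 hA2; rewrite eX1 // eX2 // E1 E2 -setXI setTI setIT.
  by rewrite QX //; exact: mX.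
have [lT _] := dT.
pose M (q : K^o * K^o) : K^o * K^o :=
  (a.1 *: q.1 + a.2 *: q.2, b.1 *: q.1 + b.2 *: q.2).
have agree D : mborel (pdist (absK : K^o -> R)) D ->
    P' ((fun w => (Y1 w, Y2 w)) @^-1` D) =
    Q ((fun w => (T (X1 w) : K^o, T (X2 w) : K^o)) @^-1` D).
  move=> mD; have [] // := indep_pair_agree hA hN ud mY1 mY2
    (random_var_dual dT mX1) (random_var_dual dT mX2) _ _ iY (indep2_dual dT iX) mD.
    move=> A hA'; rewrite eY1 //; apply/esym.
    exact: (same_law_dual dT eX1).
  move=> A hA'; rewrite eY2 //; apply/esym.
  exact: (same_law_dual dT eX2).
have mMB := mborel_orthonormal hN oab mB.
transitivity (P' ((fun w => (Y1 w, Y2 w)) @^-1` (M @^-1` B))) => //.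
rewrite !agree //.
have := gX _ _ Q X1 X2 mX1 mX2 eX1 eX2 iX a b oab _ (mborel_dual_pair dT mB).
have -> // : (fun w => (a.1 *: X1 w + a.2 *: X2 w, b.1 *: X1 w + b.2 *: X2 w)) @^-1`
    ((fun q => (T q.1, T q.2)) @^-1` B) =
    (fun w => (T (X1 w) : K^o, T (X2 w) : K^o)) @^-1` (M @^-1` B).
by apply/seteqP; split=> w /=; rewrite /M /= !lT !(formZ lT).
Qed.

(** * From linear forms to the vector *)

Lemma mule_cancelr {R : realType} (x y z : \bar R) :
  x \is a fin_num -> y \is a fin_num -> z \is a fin_num -> z != 0%E ->
  (x * z = y * z)%E -> x = y.
Proof.
move: x y z => [x| |] [y| |] [z| |] // _ _ _; rewrite eqe => z0 [/(mulIf z0) ->].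
by [].
Qed.

Section Converse.
Context {R : realType} {K : fieldType} {absK : K -> R}.
Hypothesis hK : local_field absK.
Context {V : lmodType K} {normV : V -> R}.
Hypothesis hN : nonarch_norm absK normV.
Context {d : measure_display} {O : measurableType d} {P : probability O R}.
Context {X1 X2 : O -> V}.
Hypothesis mX1 : random_var normV X1.
Hypothesis mX2 : random_var normV X2.
Hypothesis eX : same_law normV P X1 P X2.
Hypothesis iX : indep2 normV P X1 X2.
Hypothesis gX : forall T : V -> K, dual_elem absK normV T ->
  forall a b : K * K, orthonormal2 absK a b ->
  forall B, mborel (pdist (absK : K^o -> R)) B ->
  P ((fun w => (a.1 * T (X1 w) + a.2 * T (X2 w), b.1 * T (X1 w) + b.2 * T (X2 w)) : K^o * K^o)
      @^-1` B) = P ((fun w => (T (X1 w), T (X2 w)) : K^o * K^o) @^-1` B).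
Let hA : nonarch_abs absK. Proof. by case: hK. Qed.
Let hAn := abs_nonarch_norm hA.

(** This bound survives combinations with coefficients in the unit ball, such as the averaged forms
    in [cramer_wold]. *)
Definition contractive_form (T : V -> K) : Prop :=
  (forall a x y, T (a *: x + y) = a * T x + T y) /\ (forall x, absK (T x) <= normV x).

Lemma contractive_form_dual T : contractive_form T -> dual_elem absK normV T.
Proof.
move=> [lT cT]; split=> // x e e0; exists e => // y h.
by rewrite -(formB lT); apply: le_lt_trans h.
Qed.

(* An open additive subgroup of [K] stable under the unit ball, that is, a ball
   with centre 0. *)
Definition open_submodule (D : set K) : Prop :=
  [/\ (forall x y, D x -> D y -> D (x - y)),
      (forall a x, absK a <= 1 -> D x -> D (a * x)) &
      (exists2 e : R, 0 < e & forall x, absK x < e -> D x)].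

Lemma open_submodule_lt (r : R) : 0 < r -> open_submodule [set x | absK x < r].
Proof.
move=> r0; split=> [x y|a x a1 /=|] /=; first exact: (absB_lt hA).
  by apply: le_lt_trans; rewrite (absM hA) ler_piMl // (abs_ge0 hA).
by exists r.
Qed.

Lemma open_submodule_le (r : R) : 0 < r -> open_submodule [set x | absK x <= r].
Proof.
move=> r0; split=> [x y|a x a1 /=|] /=; first exact: (absB_le hA).
  by apply: le_trans; rewrite (absM hA) ler_piMl // (abs_ge0 hA).
by exists r => // x /ltW.
Qed.

Lemma open_submodule_coset D (c : K) : open_submodule D ->
  mopen (ndist (absK : K^o -> R)) [set x | D (x - c)].
Proof.
move=> [DB _ [e e0 De]] x /= Dx; exists e => // y h.
have -> : y - c = (x - c) - (x - y) by ring.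
by apply: DB => //; exact: De.
Qed.

Lemma measurable_slab T D c : contractive_form T -> open_submodule D ->
  measurable [set w | D (T (X1 w) - c)].
Proof.
move=> hT hD; apply: (mX1 (A := T @^-1` [set x | D (x - c)])).
apply: (mborel_dual (contractive_form_dual hT)).
by apply: mborel_open; exact: open_submodule_coset.
Qed.

(* Applying the Gaussian property to the orthonormal pair (1, u), (0, 1). *)
Lemma slab_translate T D (z u c : K) : contractive_form T -> open_submodule D ->
  absK u <= 1 -> P [set w | D (T (X1 w) - z)] != 0%E ->
  P [set w | D (T (X1 w) - (c + u * z))] = P [set w | D (T (X1 w) - c)].
Proof.
move=> hT hD u1 Pz; have dT := contractive_form_dual hT.
have [DB DM De] := hD.
have D0 : D 0 by case: De => e e0; apply; rewrite (abs0 hA).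
have DD x y : D x -> D y -> D (x + y).
  by move=> Dx Dy; rewrite -[y]opprK -[- y]sub0r; apply: (DB) => //; exact: DB.
pose S c : set V := T @^-1` [set x | D (x - c)].
have mS e : mborel (ndist normV) (S e).
  apply: (mborel_dual dT); apply: mborel_open; exact: open_submodule_coset.
(* Once the second coordinate is in [z + D], the sheared first coordinate lies in [c + u * z + D]
   exactly when the original one lies in [c + D]. Independence then leaves a common nonzero factor
   to cancel. *)
pose B : set (K^o * K^o) := [set q | D (q.1 - (c + u * z)) /\ D (q.2 - z)].
have mB : mborel (pdist (absK : K^o -> R)) B.
  apply: mborel_open => x [h1 h2]; have [e e0 he] := De; exists e => // y.
  rewrite /pdist gt_max => /andP[l1 l2]; split.
    have -> : y.1 - (c + u * z) = (x.1 - (c + u * z)) - (x.1 - y.1) by ring.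
    by apply: DB => //; exact: he.
  have -> : y.2 - z = (x.2 - z) - (x.2 - y.2) by ring.
  by apply: DB => //; exact: he.
have := gX dT (orthonormal2_shear hA u1) mB.
set L := _ @^-1` B; set L' := _ @^-1` B.
have -> : L = X1 @^-1` (S c) `&` X2 @^-1` (S z).
  apply/seteqP; split=> w; rewrite /L /S /B /= !mul1r mul0r add0r => -[h1 h2]; split=> //.
    have -> : T (X1 w) - c =
        (T (X1 w) + u * T (X2 w) - (c + u * z)) - u * (T (X2 w) - z) by ring.
    by apply: DB => //; exact: DM.
  have -> : T (X1 w) + u * T (X2 w) - (c + u * z) =
      T (X1 w) - c + u * (T (X2 w) - z) by ring.
  by apply: DD => //; exact: DM.
have -> : L' = X1 @^-1` (S (c + u * z)) `&` X2 @^-1` (S z) by [].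
rewrite iX; [|exact: mS..]; rewrite iX; [|exact: mS..].
move=> /esym; apply: mule_cancelr.
- by apply: fin_num_measure; apply: mX1.
- by apply: fin_num_measure; apply: mX1.
- by apply: fin_num_measure; apply: mX2.
by rewrite -eX.
Qed.

(* If |Z1| <= M has probability a > 1/2, then (Z1 + Z2, Z2) having the law of
   (Z1, Z2) gives a (1 - a) = P(|Z1 + Z2| <= M, |Z2| > M) <= (1 - a)^2. *)
Lemma form_bounded T : contractive_form T ->
  exists2 M : R, 0 < M & P [set w | M < absK (T (X1 w))] = 0%E.
Proof.
move=> hT; have dT := contractive_form_dual hT.
pose A (n : nat) := [set w | absK (T (X1 w)) <= n.+1%:R].
have mA n : measurable (A n).
  have := @measurable_slab T _ 0 hT (@open_submodule_le n.+1%:R (ltr0Sn _ _)).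
  by congr (measurable _); apply/seteqP; split=> w; rewrite /A /= subr0.
have UA : \bigcup_n A n = setT.
  apply/seteqP; split=> // w _; exists (Num.bound (absK (T (X1 w)))) => //.
  rewrite /A /= ltW // (lt_le_trans (archi_boundP (abs_ge0 hA _))) //.
  by rewrite ler_nat.
have : (P \o A) n @[n --> \oo] --> (1%:E : \bar R).
  rewrite -(probability_setT P) -UA; apply: nondecreasing_cvg_mu => //.
    by rewrite UA.
  apply/nondecreasing_seqP => n; apply/subsetPset => w /= h.
  by apply: le_trans h _; rewrite ler_nat.
move=> /fine_cvgP[_ /cvgrPdist_lt /(_ 2^-1)]; rewrite invr_gt0 ltr0n.
move=> /(_ isT)[N _ /(_ N (leqnn N))] /= hN'.
exists N.+1%:R => //.
pose C := [set x : V | absK (T x) <= N.+1%:R].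
have mC : mborel (ndist normV) C.
  apply: (mborel_dual dT (A := [set x : K^o | absK x <= N.+1%:R])); apply: mborel_open.
  have := @open_submodule_coset _ 0 (@open_submodule_le N.+1%:R (ltr0Sn _ _)).
  by congr (mopen _ _); apply/seteqP; split=> x /=; rewrite subr0.
have mC' : mborel (ndist normV) (~` C).
  by have [_ sC _] := mborel_sigma (ndist normV); rewrite -setTD; exact: sC.
pose B : set (K^o * K^o) := [set q | absK q.1 <= N.+1%:R /\ N.+1%:R < absK q.2].
have mB : mborel (pdist (absK : K^o -> R)) B.
  apply: mborel_open => x [h1 h2]; exists N.+1%:R => // y.
  rewrite /pdist gt_max => /andP[l1 l2]; split.
    by rewrite -(subKr x.1 y.1); apply: (absB_le hA) => //; exact: ltW.
  by rewrite (abs_close hA (x := x.2)) // (lt_trans l2).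
have abs1_le1 : absK 1 <= 1 by rewrite (abs1 hA).
have := gX dT (orthonormal2_shear hA abs1_le1) mB.
set L := _ @^-1` B; set L' := _ @^-1` B.
(* Comparing the pair with itself yields measurability, which is part of [prob_agree]. *)
have mL : measurable L.
  have [u ud] := local_field_separable hK.
  have [] // := indep_pair_agree hA hAn ud (random_var_dual dT mX1)
    (random_var_dual dT mX2) (random_var_dual dT mX1) (random_var_dual dT mX2) _ _
    (indep2_dual dT iX) (indep2_dual dT iX)
    (mborel_orthonormal hAn (orthonormal2_shear hA abs1_le1) mB).
have -> : L' = X1 @^-1` C `&` X2 @^-1` (~` C).
  apply/seteqP; split=> w; rewrite /L' /B /C /= => -[h1 h2]; split=> //.
    by apply/negP; rewrite -ltNge.
  by rewrite ltNge; apply/negP.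
have LC : L `<=` X1 @^-1` (~` C) `&` X2 @^-1` (~` C).
  move=> w; rewrite /L /C /= !mul1r mul0r add0r => -[h1 h2].
  split; apply/negP; rewrite -ltNge //.
  have h : absK (T (X1 w) + T (X2 w)) < absK (T (X2 w)) by exact: le_lt_trans h2.
  rewrite ltNge; apply/negP => h3; move: h2; rewrite ltNge => /negP; apply.
  rewrite -(addKr (T (X1 w)) (T (X2 w))); apply: (absD_le hA) => //.
  by rewrite (absN hA).
have mXC' : measurable (X1 @^-1` (~` C)) by exact: mX1.
have mX2C' : measurable (X2 @^-1` (~` C)) by exact: mX2.
have mXC : measurable (X1 @^-1` C) by exact: mX1.
move=> hL.
have : (P L <= P (X1 @^-1` (~` C) `&` X2 @^-1` (~` C)))%E.
  by apply: le_measure => //; rewrite inE //; exact: measurableI.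
rewrite hL iX // iX // -!eX //.
have -> : P (X1 @^-1` (~` C)) = (1 - P (X1 @^-1` C))%E.
  by rewrite -preimage_setC probability_setC.
have -> : [set w | N.+1%:R < absK (T (X1 w))] = X1 @^-1` (~` C).
  by apply/seteqP; split=> w; rewrite /C /= ltNge => /negP.
have -> : P (X1 @^-1` (~` C)) = (1 - P (X1 @^-1` C))%E.
  by rewrite -preimage_setC probability_setC.
move: hN'; rewrite -[A N]/(X1 @^-1` C).
have [a ea] : exists a, P (X1 @^-1` C) = a%:E.
  by exists (fine (P (X1 @^-1` C))); rewrite fineK //; exact: fin_num_measure.
have : (P (X1 @^-1` C) <= 1%:E)%E by exact: probability_le1.
rewrite !ea lee_fin /= => a1.
rewrite ger0_norm ?subr_ge0 // => a2.
rewrite -EFinB -!EFinM lee_fin => h; congr EFin.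
(* From [a * (1 - a) <= (1 - a) * (1 - a)] and [a > 1/2] it follows that [a = 1]. *)
nra.
Qed.

Lemma measurable_ball (T : V -> K) (c : V) (r : R) : 0 < r -> contractive_form T ->
  measurable [set w | absK (T (X1 w) - T c) < r].
Proof. by move=> r0 hT; exact: measurable_slab hT (open_submodule_lt r0). Qed.

Lemma probability_fineK (A : set O) : measurable A -> P A = (fine (P A))%:E.
Proof. by move=> mA; rewrite fineK //; exact: fin_num_measure. Qed.

(** Integrating [residue_averaging] at the entries [T k (X1 w) - T k c] expresses the mass of the
    polydisc through masses of slabs. Only slabs containing the polydisc at the same centre occur,
    so the hypothesis is limited to those. *)
Lemma cramer_wold n (T : 'I_n -> V -> K) (p : K) (c c' : V) : p != 0 ->
  (forall k, contractive_form (T k)) ->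
  (forall S D, contractive_form S -> open_submodule D ->
    (forall x, (forall k, absK (T k x) < absK p) -> D (S x)) ->
    P [set w | D (S (X1 w) - S c)] = P [set w | D (S (X1 w) - S c')]) ->
  P [set w | forall k, absK (T k (X1 w) - T k c) < absK p] =
  P [set w | forall k, absK (T k (X1 w) - T k c') < absK p].
Proof.
move=> p0 hT hS; have ap0 : 0 < absK p by rewrite (abs_gt0 hA).
have /choice[M hM] : forall k, exists M, 0 < M /\ P [set w | M < absK (T k (X1 w))] = 0%E.
  by move=> k; have [M] := form_bounded (hT k); exists M.
(* One bound for both centres, so that the same [q], [I] and [e] serve for [c] and [c']. *)
pose B := \big[Num.max/0]_k Num.max (M k) (Num.max (absK (T k c)) (absK (T k c'))).
have hB k : [/\ M k <= B, absK (T k c) <= B & absK (T k c') <= B].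
  have : Num.max (M k) (Num.max (absK (T k c)) (absK (T k c'))) <= B.
    exact: (@le_bigmax _ _ _ _ (fun k => Num.max (M k) (Num.max (absK (T k c)) (absK (T k c'))))).
  by rewrite !ge_max => /andP[-> /andP[-> ->]].
have [q [I [e [q1 I0 e1 eE]]]] := residue_averaging hK n B p0.
pose S i x := \sum_k e i k * T k x.
have cS i : contractive_form (S i).
  split=> [a x y|x].
    rewrite /S mulr_sumr -big_split; apply: eq_bigr => k _.
    by have [lT _] := hT k; rewrite lT mulrDr mulrCA.
  apply: abs_sum_le => [//|//|k _]; first exact: (norm_ge0 hN).
  rewrite (absM hA); have [_ cT] := hT k; apply: le_trans (cT x).
  by rewrite ler_piMl // (abs_ge0 hA).
have Slt i x : (forall k, absK (T k x) < absK p) -> absK (S i x) < absK p.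
  move=> hx; apply: abs_sum_lt => // k _; rewrite (absM hA).
  by apply: le_lt_trans (hx k); rewrite ler_piMl // (abs_ge0 hA).
pose L c0 i := [set w | absK (S i (X1 w) - S i c0) < absK p].
pose L' c0 i := [set w | absK (S i (X1 w) - S i c0) <= absK p].
pose C c0 := [set w | forall k, absK (T k (X1 w) - T k c0) < absK p].
have mL c0 i : measurable (L c0 i) by exact: measurable_ball.
have mL' c0 i : measurable (L' c0 i).
  exact: measurable_slab (cS i) (open_submodule_le ap0).
have mC c0 : measurable (C c0).
  have -> : C c0 = \bigcap_(k in [set: 'I_n]) [set w | absK (T k (X1 w) - T k c0) < absK p].
    by apply/seteqP; split=> w h k => [_|]; apply: h.
  apply: fin_bigcap_measurable => [|k _]; first exact: finite_finset.
  exact: measurable_ball.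
pose m := (q.-1 * #|I|)%N.
have m0 : (0 < m)%N by rewrite muln_gt0 I0 andbT -subn1 subn_gt0.
have key c0 : (forall k, absK (T k c0) <= B) ->
    \sum_(j : 'I_q * I) fine (P (L c0 j.2)) =
    \sum_i fine (P (L' c0 i)) + fine (P (C c0)) *+ m.
  move=> c0B.
  (* Multiplicities become repeated events: [q] copies of each open slab on one side, the closed
     slabs and [m] copies of the polydisc on the other. *)
  pose F (j : I + 'I_m) := match j with inl i => L' c0 i | inr _ => C c0 end.
  have mF j : measurable (F j) by case: j => j; [exact: mL'|exact: mC].
  suff hae : {ae P, forall w,
      (\sum_(j : 'I_q * I) (w \in L c0 j.2) = \sum_j (w \in F j))%N}.
    have := count_probability (fun j : 'I_q * I => mL c0 j.2) mF hae.
    rewrite big_sumType /=.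
    under eq_bigr do rewrite probability_fineK //.
    under [X in (_ = X + _)%E]eq_bigr do rewrite probability_fineK //.
    under [X in (_ = _ + X)%E]eq_bigr do rewrite probability_fineK //.
    by rewrite !sumEFin -EFinD => -[->]; rewrite sumr_const card_ord.
  have : {ae P, forall w, forall k, absK (T k (X1 w)) <= M k}.
    apply: filter_forall => k; have [Mk0 Mk] := hM k.
    exists [set w | M k < absK (T k (X1 w))]; split=> //.
      have -> : [set w | M k < absK (T k (X1 w))] =
          ~` [set w | absK (T k (X1 w) - 0) <= M k].
        by apply/seteqP; split=> w /=; rewrite subr0 ltNge => /negP.
      by apply: measurableC; exact: measurable_slab (hT k) (open_submodule_le Mk0).
    by move=> w /= /negP; rewrite -ltNge.
  apply: filterS => w hw.
  have xB k : absK (T k (X1 w) - T k c0) <= B.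
    by apply: (absB_le hA) => //; apply: le_trans (hw k) _; have [] := hB k.
  have := eE _ xB.
  have SE i : \sum_k e i k * (T k (X1 w) - T k c0) = S i (X1 w) - S i c0.
    by rewrite /S -sumrB; apply: eq_bigr => k _; rewrite mulrBr.
  under eq_bigr do rewrite SE; under [in RHS]eq_bigr do rewrite SE.
  rewrite big_sumType /= => H'.
  rewrite -(pair_bigA _ (fun (_ : 'I_q) i => (w \in L c0 i) : nat)) /=.
  rewrite sum_nat_const card_ord.
  have LE i : (w \in L c0 i) = (absK (S i (X1 w) - S i c0) < absK p).
    by apply/idP/idP; rewrite inE.
  have LE' i : (w \in L' c0 i) = (absK (S i (X1 w) - S i c0) <= absK p).
    by apply/idP/idP; rewrite inE.
  have CE : (w \in C c0) = [forall k, absK (T k (X1 w) - T k c0) < absK p].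
    by apply/idP/forallP; rewrite inE.
  under eq_bigr do rewrite LE; under [in RHS]eq_bigr do rewrite LE'.
  by rewrite H' sum_nat_const card_ord CE.
have := key c (fun k => let: And3 _ h _ := hB k in h).
have -> : \sum_(j : 'I_q * I) fine (P (L c j.2)) = \sum_(j : 'I_q * I) fine (P (L c' j.2)).
  by apply: eq_bigr => j _; rewrite /L (hS (S j.2) _ (cS j.2) (open_submodule_lt ap0) (Slt j.2)).
rewrite key; last by move=> k; have [] := hB k.
have -> : \sum_i fine (P (L' c' i)) = \sum_i fine (P (L' c i)).
  apply: eq_bigr => i _; rewrite /L' (hS (S i) _ (cS i) (open_submodule_le ap0)) // => x h.
  exact: ltW (Slt i x h).
move=> /addrI /(pmulrnI m0) eC.
by rewrite -/(C c) -/(C c') probability_fineK // [RHS]probability_fineK // eC.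
Qed.

(** * Polydiscs cut out by countably many forms *)

Section Polydisc.
Context {T : nat -> V -> K}.
Hypothesis hT : forall k, contractive_form (T k).
Let linT k := (hT k).1.

Definition polydisc (p : K) (c : V) : set V :=
  [set x | forall k, absK (T k x - T k c) < absK p].

Lemma polydisc_sym p x y : polydisc p x y -> polydisc p y x.
Proof. by move=> h k; rewrite (absBC hA). Qed.

Lemma polydisc_trans p x y z : polydisc p x y -> polydisc p y z -> polydisc p x z.
Proof. by move=> h1 h2 k; exact: (abs_dist_lt hA (h2 k) (h1 k)). Qed.

Lemma polydisc_comb p (a b : K) (x x' y y' : V) : absK a <= 1 -> absK b <= 1 ->
  polydisc p x x' -> polydisc p y y' ->
  polydisc p (a *: x + b *: y) (a *: x' + b *: y').
Proof.
move=> a1 b1 hx hy k; rewrite !linT !(formZ (linT k)).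
have -> : a * T k x' + b * T k y' - (a * T k x + b * T k y) =
  a * (T k x' - T k x) + b * (T k y' - T k y) by ring.
apply: (absD_lt hA); rewrite (absM hA).
  by apply: le_lt_trans (hx k); rewrite ler_piMl // (abs_ge0 hA).
by apply: le_lt_trans (hy k); rewrite ler_piMl // (abs_ge0 hA).
Qed.

Lemma norm_polydisc p c x : normV (x - c) < absK p -> polydisc p c x.
Proof.
move=> h k; rewrite -(formB (linT k)); apply: le_lt_trans h.
by have [_ cT] := hT k; exact: cT.
Qed.

Lemma mborel_polydisc p c : p != 0 -> mborel (ndist normV) (polydisc p c).
Proof.
move=> p0; apply: mborel_open => x hx; exists (absK p); first by rewrite (abs_gt0 hA).
move=> y h; apply: polydisc_trans hx _; apply: norm_polydisc.
by rewrite (normBC hA hN).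
Qed.

(** The polydisc is the decreasing limit of its truncations to finitely many forms, to which
    [cramer_wold] applies. Each slab involved, centred at [z], contains the polydisc at [z] and so
    has positive mass, as [slab_translate] requires. *)
Lemma polydisc_translate p z (u : K) c : p != 0 -> absK u <= 1 ->
  P (X1 @^-1` polydisc p z) != 0%E ->
  P (X1 @^-1` polydisc p (c + u *: z)) = P (X1 @^-1` polydisc p c).
Proof.
move=> p0 u1 Pz; have ap0 : 0 < absK p by rewrite (abs_gt0 hA).
pose F c n := [set w | forall k : 'I_n, absK (T k (X1 w) - T k c) < absK p].
have mF c0 n : measurable (F c0 n).
  have -> : F c0 n = \bigcap_(k in [set: 'I_n]) [set w | absK (T k (X1 w) - T k c0) < absK p].
    by apply/seteqP; split=> w h k => [_|]; apply: h.
  apply: fin_bigcap_measurable => [|k _]; first exact: finite_finset.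
  exact: measurable_ball.
have capF c0 : X1 @^-1` polydisc p c0 = \bigcap_n F c0 n.
  apply/seteqP; split=> w h k; first by move=> _ i; exact: h.
  exact: (h k.+1 I ord_max).
have limF c0 : (P \o F c0) n @[n --> \oo] --> P (X1 @^-1` polydisc p c0).
  rewrite capF; apply: nonincreasing_cvg_mu => //.
  - by rewrite (le_lt_trans (probability_le1 P (mF c0 0%N))) // ltry.
  - exact: bigcapT_measurable.
  - apply/nonincreasing_seqP => n; apply/subsetPset => w h k.
    exact: (h (widen_ord (leqnSn n) k)).
suff EF : P \o F (c + u *: z) = P \o F c.
  by apply: cvg_unique (limF _) _ => //; rewrite EF; exact: limF.
apply/funext => n /=; apply: (@cramer_wold n (fun k => T k) p) => // S D cS hD hSD.
have [lS _] := cS.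
have -> : S (c + u *: z) = S c + u * S z by rewrite addrC lS addrC.
apply: (@slab_translate S D) => //.
have le : (P (X1 @^-1` polydisc p z) <= P [set w | D (S (X1 w) - S z)%R])%E.
  apply: le_measure; rewrite ?inE; [|exact: (@measurable_slab S D (S z))|].
    by apply: mX1; exact: mborel_polydisc.
  by move=> w h /=; rewrite -(formB lS); apply: hSD => k; rewrite (formB (linT k)); exact: h.
by apply: contra_neq Pz => h0; move: le; rewrite h0 measure_le0 => /eqP.
Qed.

(* Both laws are uniform, at the scale of the polydisc, on the same module over
   the unit ball of [K]. *)
Lemma polydisc_pair p a b c c' : p != 0 -> orthonormal2 absK a b ->
  prob_agree P (fun w => (a.1 *: X1 w + a.2 *: X2 w, b.1 *: X1 w + b.2 *: X2 w))
    P (fun w => (X1 w, X2 w)) [set q | polydisc p c q.1 /\ polydisc p c' q.2].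
Proof.
move=> p0 oab; have [oa ob _] := oab.
have [a1 a2] := norm2_eq1 oa; have [b1 b2] := norm2_eq1 ob.
have D1 := orthonormal2_det hA oab; set D := _ - _ in D1.
have D0 : D != 0 by rewrite -(abs_gt0 hA) D1.
have div1 x : absK x <= 1 -> absK (x / D) <= 1.
  by move=> x1; rewrite (absM hA) (absV hA) D1 invr1 mulr1.
(* The pair [(e, e')] is the image of [(c, c')] under the inverse matrix, given by Cramer's rule. *)
pose e := (b.2 / D) *: c + (- a.2 / D) *: c'.
pose e' := (- b.1 / D) *: c + (a.1 / D) *: c'.
have solve (x y : V) : (b.2 / D) *: (a.1 *: x + a.2 *: y) + (- a.2 / D) *: (b.1 *: x + b.2 *: y) = x.
  rewrite !scalerDr !scalerA addrACA -!scalerDl.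
  have -> : b.2 / D * a.1 + - a.2 / D * b.1 = 1.
    by rewrite -(divff D0) /D; ring.
  have -> : b.2 / D * a.2 + - a.2 / D * b.2 = 0 by ring.
  by rewrite scale1r scale0r addr0.
have solve' (x y : V) : (- b.1 / D) *: (a.1 *: x + a.2 *: y) + (a.1 / D) *: (b.1 *: x + b.2 *: y) = y.
  rewrite !scalerDr !scalerA addrACA -!scalerDl.
  have -> : - b.1 / D * a.2 + a.1 / D * b.2 = 1.
    by rewrite -(divff D0) /D; ring.
  have -> : - b.1 / D * a.1 + a.1 / D * b.1 = 0 by ring.
  by rewrite scale1r scale0r add0r.
have ae : a.1 *: e + a.2 *: e' = c.
  rewrite !scalerDr !scalerA addrACA -!scalerDl.
  have -> : a.1 * (b.2 / D) + a.2 * (- b.1 / D) = 1 by rewrite -(divff D0) /D; ring.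
  have -> : a.1 * (- a.2 / D) + a.2 * (a.1 / D) = 0 by ring.
  by rewrite scale1r scale0r addr0.
have be : b.1 *: e + b.2 *: e' = c'.
  rewrite !scalerDr !scalerA addrACA -!scalerDl.
  have -> : b.1 * (b.2 / D) + b.2 * (- b.1 / D) = 0 by ring.
  have -> : b.1 * (- a.2 / D) + b.2 * (a.1 / D) = 1 by rewrite -(divff D0) /D; ring.
  by rewrite scale1r scale0r add0r.
have mC c0 := mborel_polydisc c0 p0.
rewrite /prob_agree; set L := _ @^-1` _; set L' := _ @^-1` _.
(* The matrix and its inverse both have entries in the unit ball, so both preserve closeness at the
   scale of the polydisc. *)
have EL : L = X1 @^-1` polydisc p e `&` X2 @^-1` polydisc p e'.
  apply/seteqP; split=> w; rewrite /L /= => -[h1 h2].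
    split; [rewrite -(solve (X1 w) (X2 w))|rewrite -(solve' (X1 w) (X2 w))];
      by apply: polydisc_comb => //; apply: div1; rewrite ?(absN hA).
  by split; [rewrite -ae|rewrite -be]; apply: polydisc_comb.
have EL' : L' = X1 @^-1` polydisc p c `&` X2 @^-1` polydisc p c' by [].
pose m c0 := P (X1 @^-1` polydisc p c0).
have mcomb (x y : V) (s t : K) : absK s <= 1 -> absK t <= 1 -> m x != 0%E -> m y != 0%E ->
    m (s *: x + t *: y) = m 0.
  move=> s1 t1 x0 y0; rewrite /m polydisc_translate // -[s *: x]add0r.
  exact: polydisc_translate.
have mself x : m x != 0%E -> m x = m 0.
  move=> x0; have := mcomb x x 1 0; rewrite (abs1 hA) (abs0 hA) scale1r scale0r addr0.
  exact.
split.
- by rewrite EL; apply: measurableI; [apply: mX1|apply: mX2]; exact: mC.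
- by rewrite EL'; apply: measurableI; [apply: mX1|apply: mX2]; exact: mC.
rewrite EL EL' iX // iX // -!eX // -/(m e) -/(m e') -/(m c) -/(m c').
(* Each of the pairs [(c, c')] and [(e, e')] consists of unit-ball combinations of the other. If one
   pair has two nonzero masses, all four masses equal [m 0]; otherwise both products vanish. *)
have [e0|e0] := eqVneq (m e * m e')%E 0%E; last first.
  have [m1 m2] : m e != 0%E /\ m e' != 0%E by move: e0; rewrite mule_eq0 negb_or => /andP.
  have -> : m c = m 0 by rewrite -ae mcomb.
  have -> : m c' = m 0 by rewrite -be mcomb.
  by rewrite (mself _ m1) (mself _ m2).
rewrite e0; apply/esym/eqP; move: e0; apply: contra_eqT.
rewrite (mule_eq0 (m c)) negb_or => /andP[m1 m2].
have -> : m e = m 0 by rewrite mcomb // div1 // (absN hA).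
have -> : m e' = m 0 by rewrite mcomb // div1 // (absN hA).
by rewrite mule_eq0 negb_or -{1}(mself _ m1) m1 -(mself _ m1) m1.
Qed.

End Polydisc.

(** With norming forms, polydiscs of radius [absK t ^+ m] give nested partitions into open sets of
    vanishing diameter, so agreement on products of two polydiscs extends to all Borel sets of
    pairs. *)
Lemma orthonormal_invariance (u : nat -> V) :
  (forall x (e : R), 0 < e -> exists n, normV (x - u n) < e) ->
  forall a b, orthonormal2 absK a b -> forall B, mborel (pdist normV) B ->
  P ((fun w => (a.1 *: X1 w + a.2 *: X2 w, b.1 *: X1 w + b.2 *: X2 w)) @^-1` B) =
  P ((fun w => (X1 w, X2 w)) @^-1` B).
Proof.
move=> ud a b oab B mB.
have [T [s [s0 lT cT nT]]] := norming_functionals hK hN ud.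
have hT k : contractive_form (T k) by split.
have [_ [t /andP[t0 t1]] _] := hK.
have tm0 m : t ^+ m != 0 by rewrite expf_neq0 // -(abs_gt0 hA).
pose r (m : nat) (x y : V * V) :=
  polydisc (T := T) (t ^+ m) x.1 y.1 /\ polydisc (T := T) (t ^+ m) x.2 y.2.
suff [] : prob_agree P (fun w => (a.1 *: X1 w + a.2 *: X2 w, b.1 *: X1 w + b.2 *: X2 w))
    P (fun w => (X1 w, X2 w)) B by [].
move: B mB; apply: (@prob_agree_classes _ _ _ r (pair_seq (u := u))).
- by move=> m x y [h1 h2]; split; exact: polydisc_sym.
- by move=> m x y z [h1 h2] [h3 h4]; split; [exact: polydisc_trans h1 h3|exact: polydisc_trans h2 h4].
- move=> m n x y mn; have tmn : absK (t ^+ n) <= absK (t ^+ m).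
    by rewrite !(absX hA) ler_wiXn2l // ltW.
  by move=> [h1 h2]; split=> k; [exact: lt_le_trans (h1 k) tmn|exact: lt_le_trans (h2 k) tmn].
- move=> m x; have tm : 0 < absK (t ^+ m) by rewrite (abs_gt0 hA).
  have [n] := pair_seq_dense hA hN ud x tm; rewrite /pdist gt_max => /andP[h1 h2].
  by exists n; split; apply: norm_polydisc => //; rewrite (normBC hA hN).
(* The factor [s] is the loss in the norming inequality [s * normV x <= absK (T k x)]. *)
- move=> e e0; have [m hm] : exists m, absK t ^+ m < s * e.
    by apply: expr_lt_eps; rewrite ?(ltW t0) ?mulr_gt0.
  have small x y : polydisc (T := T) (t ^+ m) x y -> normV (x - y) < e.
    move=> h; have [k hk] := nT (x - y); rewrite -(ltr_pM2l s0).
    apply: le_lt_trans hk _; rewrite (formB (lT k)) (absBC hA).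
    by apply: lt_trans (h k) _; rewrite (absX hA).
  by exists m => x y [h1 h2]; rewrite /pdist gt_max !small.
by move=> m x; exact: polydisc_pair.
Qed.

End Converse.

Theorem theorem4p4 (R : realType) (K : fieldType) (absK : K -> R)
  (E : lmodType K) (normE : E -> R)
  (d : measure_display) (O : measurableType d) (P : probability O R) (X : O -> E) :
  local_field absK ->
  separable_banach absK normE ->
  random_var normE X ->
  (KGaussian absK normE P X <->
   (forall T : E -> K, dual_elem absK normE T ->
      KGaussian absK (V := K^o) absK P (fun w => (T (X w) : K^o)))).
Proof.
move=> hK [hN _ [u ud]] mX; split=> [gX T dT|gT]; first exact: KGaussian_dual gX.
move=> d' O' P' X1 X2 mX1 mX2 e1 e2 iX a b oab B mB.
apply: (orthonormal_invariance hK hN mX1 mX2 _ iX _ ud oab mB).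
  by move=> A mA; rewrite e1 // e2.
move=> T dT a' b' oab' B' mB'.
exact: (gT T dT _ _ P' _ _ (random_var_dual dT mX1) (random_var_dual dT mX2)
  (same_law_dual dT e1) (same_law_dual dT e2) (indep2_dual dT iX) _ _ oab' _ mB').
Qed.
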